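(* For every $i\in\{A,B,C\}$, the entanglement measures $\mathcal{T}_{min}^{(i)}$ and $\mathcal{T}_{GM}^{(i)}$ on three-qubit states are genuine multipartite entanglement (GME) measures. That is, for each $E\in\{\mathcal{T}_{min}^{(i)},\mathcal{T}_{GM}^{(i)}\}$: (i) for every three-qubit state $\rho$, $E(\rho)>0$ if and only if $\rho$ is not biseparable; (ii) $E$ is invariant under local unitary transformations; (iii) $E$ is not increasing on average under LOCC, i.e. if an LOCC transformation applied to $\rho$ yields states $\{\rho_k\}$ with probabilities $\{p_k\}$, then $\sum_k p_kE(\rho_k)\le E(\rho)$; (iv) $E$ is convex.
   Context: Setting: three qubits $A,B,C$, with Hilbert space $\mathbb{C}^2\otimes\mathbb{C}^2\otimes\mathbb{C}^2$; states are density operators, pure states are unit vectors. Fully entangled fraction: for a two-qubit state $\rho$, $f(\rho)=\max_{|e\rangle}\langle e|\rho|e\rangle$, the maximum being over all maximally entangled unit vectors $|e\rangle\in\mathbb{C}^2\otimes\mathbb{C}^2$ (both reduced states equal to $I/2$). Maximal average teleportation fidelity: for distinct $i,j,k\in\{A,B,C\}$, $$F_{ij}(\rho_{ABC})=\frac{2f_{ij}(\rho_{ABC})+1}{3},\qquad f_{ij}(\rho_{ABC})=\max_{U_k}\sum_{t=0}^{1}\langle t|U_k\rho_kU_k^\dagger|t\rangle\, f\!\left(\rho_{ij}^{U_k,t}\right),$$ where $U_k$ ranges over $2\times2$ unitaries on system $k$, $\rho_k$ is the reduced state of $k$, and $\rho_{ij}^{U_k,t}$ is the normalized state of systems $i,j$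 after measuring $k$ in the orthonormal basis $\{U_k^\dagger|0\rangle,U_k^\dagger|1\rangle\}$ and obtaining outcome $t$ (zero-probability terms count as $0$). $F_{ij}=F_{ji}$. Known formula (from earlier literature) for pure states: $F_{ij}(|\phi\rangle_{ABC})=\frac{1}{3}\left(\sqrt{\tau+C_{ij}^2}+2\right)$, where $C_{ij}$ is the (Wootters) concurrence of the two-qubit reduced state $\rho_{ij}$ of $|\phi\rangle$, $C_{i(jk)}=\sqrt{2(1-\mathrm{Tr}\,\rho_i^2)}$, and $\tau=C_{i(jk)}^2-C_{ij}^2-C_{ik}^2$ is the three-tangle (independent of the choice of $i$). Measures: for a three-qubit pure state let $\mathcal{T}_{ij}=3F_{ij}-2$. For distinct $i,j,k$ in $\{A,B,C\}$ define on pure states $$\mathcal{T}_{min}^{(i)}=\min\{\mathcal{T}_{ij},\mathcal{T}_{ik}\},\qquad \mathcal{T}_{GM}^{(i)}=\sqrt{\mathcal{T}_{ij}\mathcal{T}_{ik}}.$$ On mixed states both are defined by the convex roof $E(\rho)=\min\sum_l p_lE(|\psi_l\rangle)$, the minimum being over all decompositions $\rho=\sum_l p_l|\psi_l\rangle\langle\psi_l|$ into pure states. Biseparable: a pure state is biseparable if it is a product vector with respect to some bipartition of the set of parties into two nonempty subsets; a mixed state is biseparable if it is a convex combination of biseparable pure states (possibly with respect to different bipartitions). LOCC: a finite sequence of rounds; in each round one party, chosen depending on earlier outcomes, performs on its qubit a measurement given by $2\times2$ operators $\{M_t\}$ with $\sum_tM_t^\dagger M_t=I$ (also chosen depending on earlier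 outcomes) and announces the outcome; the state is updated to $M_t\rho M_t^\dagger/\mathrm{Tr}(M_t\rho M_t^\dagger)$ with probability $\mathrm{Tr}(M_t\rho M_t^\dagger)$. Part of the classical record may be discarded, so that the corresponding states are averaged. *)

(* Defs.v *)
From mathcomp Require Import all_boot all_order all_algebra.
From mathcomp Require Import complex mxtens.
From mathcomp Require Import classical_sets reals.

Set Implicit Arguments.
Unset Strict Implicit.
Unset Printing Implicit Defensive.

Import Order.TTheory GRing.Theory Num.Theory.
Local Open Scope classical_set_scope.
Local Open Scope ring_scope.
Local Open Scope complex_scope.
Local Open Scope sesquilinear_scope.

Definition party := 'I_3.

(* The three-qubit space is C^2 (x) C^2 (x) C^2 with the Kronecker ordering of
   the product basis: cbasis x is the index of |x 0> (x) |x 1> (x) |x 2>. *)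
Notation qubit3 := (2 * 2 * 2)%N.

Definition cbasis (x : party -> 'I_2) : 'I_qubit3 :=
  mxtens_index (mxtens_index (x ord0, x (inord 1)), x ord_max).

(* Meant for i, j, k the three distinct parties. *)
Definition assign (i j k : party) (a b c : 'I_2) : party -> 'I_2 :=
  fun p => if p == i then a else if p == j then b else c.

Section Quantum.
Variable R : realType.
Local Notation C := R[i].

Definition proj n (psi : 'cV[C]_n) : 'M[C]_n := psi *m psi ^t*.

Definition unit_vector n (psi : 'cV[C]_n) : Prop := psi ^t* *m psi = 1%:M.

(* <e|rho|e>, which is real for Hermitian rho. *)
Definition expval n (rho : 'M[C]_n) (e : 'cV[C]_n) : R :=
  complex.Re ((e ^t* *m rho *m e) 0 0).

Definition rtrace n (rho : 'M[C]_n) : R := complex.Re (\tr rho).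

(* In R[i], 0 <= z says that z is real and nonnegative. *)
Definition density n (rho : 'M[C]_n) : Prop :=
  [/\ rho ^t* = rho,
      forall v : 'cV[C]_n, 0 <= (v ^t* *m rho *m v) 0 0
    & \tr rho = 1].

Definition ptrace1 (rho : 'M[C]_(2 * 2)) : 'M[C]_2 :=
  \matrix_(s, t) \sum_a rho (mxtens_index (a, s)) (mxtens_index (a, t)).

Definition ptrace2 (rho : 'M[C]_(2 * 2)) : 'M[C]_2 :=
  \matrix_(s, t) \sum_a rho (mxtens_index (s, a)) (mxtens_index (t, a)).

Definition max_entangled (e : 'cV[C]_(2 * 2)) : Prop :=
  [/\ unit_vector e,
      ptrace1 (proj e) = (2%:R^-1)%:M
    & ptrace2 (proj e) = (2%:R^-1)%:M].

(* Maxima and minima are written sup and inf: they are taken over nonempty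
   bounded sets on which they are attained. *)
Definition fef (rho : 'M[C]_(2 * 2)) : R :=
  sup [set x | exists2 e, max_entangled e & x = expval rho e].

Definition tens3 (N : party -> 'M[C]_2) : 'M[C]_qubit3 :=
  N ord0 *t N (inord 1) *t N ord_max.

Definition local_op (i : party) (M : 'M[C]_2) : 'M[C]_qubit3 :=
  tens3 (fun p => if p == i then M else 1%:M).

(* Reduced state of the ordered pair (i, j), tracing out the third party k. *)
Definition reduced2 (i j k : party) (rho : 'M[C]_qubit3) : 'M[C]_(2 * 2) :=
  \matrix_(x, y) \sum_c
    rho (cbasis (assign i j k (mxtens_unindex x).1 (mxtens_unindex x).2 c))
        (cbasis (assign i j k (mxtens_unindex y).1 (mxtens_unindex y).2 c)).

(* Reduced state of party k, tracing out the other two parties i and j. *)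
Definition reduced1 (i j k : party) (rho : 'M[C]_qubit3) : 'M[C]_2 :=
  \matrix_(s, t) \sum_a \sum_b
    rho (cbasis (assign i j k a b s)) (cbasis (assign i j k a b t)).

Definition ket (t : 'I_2) : 'cV[C]_2 := delta_mx t 0.

Definition meas_prob (i j k : party) (U : 'M[C]_2) (rho : 'M[C]_qubit3)
    (t : 'I_2) : R :=
  expval (U *m reduced1 i j k rho *m U ^t*) (ket t).

(* Normalized state of (i, j) after k is projected on U^dagger |t>.
   At probability zero this is the zero matrix, as 0^-1 = 0. *)
Definition meas_state (i j k : party) (U : 'M[C]_2) (rho : 'M[C]_qubit3)
    (t : 'I_2) : 'M[C]_(2 * 2) :=
  let P := local_op k (proj (U ^t* *m ket t)) in
  ((meas_prob i j k U rho t)^-1)%:C *: reduced2 i j k (P *m rho *m P ^t*).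

(* f_ij and F_ij; k is the third party. *)
Definition tele_fef (i j k : party) (rho : 'M[C]_qubit3) : R :=
  sup [set x | exists2 U : 'M[C]_2, U \is unitarymx &
    x = \sum_t meas_prob i j k U rho t * fef (meas_state i j k U rho t)].

Definition tele_fidelity (i j k : party) (rho : 'M[C]_qubit3) : R :=
  (2%:R * tele_fef i j k rho + 1) / 3%:R.

Definition tele_cap (i j k : party) (psi : 'cV[C]_qubit3) : R :=
  3%:R * tele_fidelity i j k (proj psi) - 2%:R.

(* T_min^(i) and T_GM^(i) on pure states; j and k are the other two parties. *)
Definition Tmin (i j k : party) (psi : 'cV[C]_qubit3) : R :=
  Num.min (tele_cap i j k psi) (tele_cap i k j psi).

Definition TGM (i j k : party) (psi : 'cV[C]_qubit3) : R :=
  Num.sqrt (tele_cap i j k psi * tele_cap i k j psi).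

Definition distribution n (p : 'I_n -> R) : Prop :=
  (forall l, 0 <= p l) /\ \sum_l p l = 1.

Definition decomposition (rho : 'M[C]_qubit3) n (p : 'I_n -> R)
    (psi : 'I_n -> 'cV[C]_qubit3) : Prop :=
  [/\ distribution p,
      forall l, unit_vector (psi l)
    & rho = \sum_l (p l)%:C *: proj (psi l)].

Definition convex_roof (E : 'cV[C]_qubit3 -> R) (rho : 'M[C]_qubit3) : R :=
  inf [set x | exists n (p : 'I_n -> R) (psi : 'I_n -> 'cV[C]_qubit3),
    decomposition rho p psi /\ x = \sum_l p l * E (psi l)].

(* A bipartition of three parties into nonempty subsets is {i} | {j, k}. *)
Definition biseparable_pure (psi : 'cV[C]_qubit3) : Prop :=
  exists i j k : party, uniq [:: i; j; k] /\
  exists (a : 'cV[C]_2) (b : 'cV[C]_(2 * 2)), forall s t u,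
    psi (cbasis (assign i j k s t u)) 0 = a s 0 * b (mxtens_index (t, u)) 0.

Definition biseparable (rho : 'M[C]_qubit3) : Prop :=
  exists n (p : 'I_n -> R) (psi : 'I_n -> 'cV[C]_qubit3),
    decomposition rho p psi /\ forall l, biseparable_pure (psi l).

(* An LOCC protocol is a finite tree: Round i M next is a measurement of party i
   with operators M, continued by next s after outcome s. The leaves carry the
   part of the classical record that is kept in the end: branches whose leaves
   have equal labels are averaged. *)
Inductive protocol (m : nat) : Type :=
| Stop of 'I_m
| Round (i : party) (n : nat) (M : 'I_n -> 'M[C]_2) (next : 'I_n -> protocol m).

Fixpoint valid_protocol m (T : protocol m) : Prop :=
  match T with
  | Stop _ => True
  | Round i n M next =>
      \sum_s (M s) ^t* *m M s = 1%:M /\ forall s, valid_protocol (next s)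
  end.

Definition outcome_prob (i : party) (M : 'M[C]_2) (rho : 'M[C]_qubit3) : R :=
  rtrace (local_op i M *m rho *m (local_op i M) ^t*).

(* The zero matrix at probability zero. *)
Definition outcome_state (i : party) (M : 'M[C]_2) (rho : 'M[C]_qubit3) :
    'M[C]_qubit3 :=
  ((outcome_prob i M rho)^-1)%:C *:
    (local_op i M *m rho *m (local_op i M) ^t*).

Fixpoint label_prob m (T : protocol m) (rho : 'M[C]_qubit3) (k : 'I_m) : R :=
  match T with
  | Stop l => (l == k)%:R
  | Round i n M next =>
      \sum_s outcome_prob i (M s) rho
             * label_prob (next s) (outcome_state i (M s) rho) k
  end.

(* Sum of the final states of the branches labelled k, each weighted by the
   probability of its branch. *)
Fixpoint label_mass m (T : protocol m) (rho : 'M[C]_qubit3) (k : 'I_m) :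
    'M[C]_qubit3 :=
  match T with
  | Stop l => if l == k then rho else 0
  | Round i n M next =>
      \sum_s (outcome_prob i (M s) rho)%:C
             *: label_mass (next s) (outcome_state i (M s) rho) k
  end.

Definition label_state m (T : protocol m) (rho : 'M[C]_qubit3) (k : 'I_m) :
    'M[C]_qubit3 :=
  ((label_prob T rho k)^-1)%:C *: label_mass T rho k.

Definition detects_GME (E : 'M[C]_qubit3 -> R) : Prop :=
  forall rho, density rho -> (0 < E rho <-> ~ biseparable rho).

Definition LU_invariant (E : 'M[C]_qubit3 -> R) : Prop :=
  forall rho (U : party -> 'M[C]_2), density rho ->
    (forall p, U p \is unitarymx) ->
    E (tens3 U *m rho *m (tens3 U) ^t*) = E rho.

Definition LOCC_monotone (E : 'M[C]_qubit3 -> R) : Prop :=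
  forall rho m (T : protocol m), density rho -> valid_protocol T ->
    \sum_k label_prob T rho k * E (label_state T rho k) <= E rho.

Definition convex_measure (E : 'M[C]_qubit3 -> R) : Prop :=
  forall n (p : 'I_n -> R) (rho : 'I_n -> 'M[C]_qubit3),
    distribution p -> (forall l, density (rho l)) ->
    E (\sum_l (p l)%:C *: rho l) <= \sum_l p l * E (rho l).

Definition GME_measure (E : 'M[C]_qubit3 -> R) : Prop :=
  [/\ detects_GME E, LU_invariant E, LOCC_monotone E & convex_measure E].

End Quantum.

(* Main.v *)
Require Import Defs.
From mathcomp Require Import all_boot all_order all_algebra.
From mathcomp Require Import complex mxtens.
From mathcomp Require Import ring lra.
From mathcomp Require Import boolp classical_sets reals.
From mathcomp Require Import topology normedtype derive realfun.

(** Write the amplitudes of a pure state [psi] as two 2 x 2 matrices [A_0, A_1]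
    (the slices along party [k]), and let [S] be the symmetric matrix of the
    quadratic form [x |-> det (x_0 A_0 + x_1 A_1)]. A measurement of [k] in the
    basis given by a unitary [U] leaves [i, j] in pure states whose fully
    entangled fractions average to [1/2 + sum_t |(U S U^T)_tt|]; by Takagi's
    factorisation the maximum over [U] is [1/2 + |S|_1], so that
    [T_ij = 2 |S|_1] with [|S|_1 ^ 2 = |S|_F ^ 2 + 2 |det S|].

    A local operator [M] on [i] or [j] replaces [S] by [(det M) S], and on [k]
    by [M S M^T]; in both cases [|S|_1] decreases on average, hence so do the
    minimum and the geometric mean of [T_ij] and [T_ik]. Moreover [S = 0] says
    that the pencil [x_0 A_0 + x_1 A_1] has rank at most one everywhere, i.e.
    that [psi] is a product [i | jk] or [j | ik]; so [T_ij T_ik = 0] exactly on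
    biseparable vectors.

    All these quantities are homogeneous of degree two in [psi], so the convex
    roof extends to unnormalised states, where monotonicity passes to it by
    induction on protocols. By Caratheodory's theorem decompositions may be
    taken of bounded length, and compactness makes the infimum attained, which
    gives positivity outside the biseparable states. *)

Set Implicit Arguments.
Unset Strict Implicit.
Unset Printing Implicit Defensive.

Import Order.TTheory GRing.Theory Num.Theory numFieldNormedType.Exports.
Local Open Scope classical_set_scope.
Local Open Scope ring_scope.
Local Open Scope complex_scope.
Local Open Scope sesquilinear_scope.

Local Notation cj A := (map_mx Num.conj A).

(** * Nuclear norm of 2 x 2 matrices *)

Section TwoByTwo.
Variable R : realType.
Local Notation C := R[i].
Local Notation normc := (@ComplexField.Normc.normc R).
Implicit Types (z : C) (M G : 'M[C]_2).

Lemma lift01 : lift (0 : 'I_2) 0 = 1. Proof. exact/val_inj. Qed.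

Lemma lift10 : lift (1 : 'I_2) 0 = 0. Proof. exact/val_inj. Qed.

Lemma sum2 (V : nmodType) (F : 'I_2 -> V) : \sum_a F a = F 0 + F 1.
Proof. by rewrite !big_ord_recl big_ord0 addr0 lift01. Qed.

Lemma conjcM (x y : C) : conjc (x * y) = conjc x * conjc y.
Proof. exact: rmorphM. Qed.

Lemma conjcD (x y : C) : conjc (x + y) = conjc x + conjc y.
Proof. exact: rmorphD. Qed.

Lemma conjcN (x : C) : conjc (- x) = - conjc x.
Proof. exact: rmorphN. Qed.

Lemma normc_ge0 z : 0 <= normc z.
Proof. by case: z => a b /=; rewrite sqrtr_ge0. Qed.

Lemma normc_sqrE z : normc z ^+ 2 = complex.Re z ^+ 2 + complex.Im z ^+ 2.
Proof. by case: z => a b /=; rewrite sqr_sqrtr // addr_ge0 ?sqr_ge0. Qed.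

Lemma mulr_conjc z : z * conjc z = (normc z ^+ 2)%:C.
Proof. by rewrite normc_sqrE; case: z => a b; rewrite /=; simpc; congr (_ +i* _); ring. Qed.

Lemma normc_conjc z : normc (conjc z) = normc z.
Proof. by case: z => a b /=; rewrite sqrrN. Qed.

Lemma normcR (x : R) : normc x%:C = `|x|.
Proof. by rewrite /= expr0n addr0 sqrtr_sqr. Qed.

Lemma normc_sum (I : Type) (r : seq I) (F : I -> C) :
  normc (\sum_(i <- r) F i) <= \sum_(i <- r) normc (F i).
Proof.
elim/big_ind2: _ => [|x1 x2 y1 y2 h1 h2|//]; first by rewrite ComplexField.Normc.normc0.
exact: le_trans (le_normcD _ _) (lerD h1 h2).
Qed.

Lemma conjmxE n m (A : 'M[C]_(n, m)) a b : (A ^t*) a b = conjc (A b a).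
Proof. by rewrite !mxE. Qed.

(** The square of the Frobenius norm; for a vector, its squared length. *)
Definition frob (n m : nat) (A : 'M[C]_(n, m)) : R := \sum_a \sum_b normc (A a b) ^+ 2.

(* The nuclear norm [s + s'] from the singular values [s, s']:
   [(s + s') ^ 2 = s ^ 2 + s' ^ 2 + 2 s s' = |M|_F ^ 2 + 2 |det M|]. *)
Definition nucl2 M : R := frob M + 2 * normc (\det M).

Definition nucl M : R := Num.sqrt (nucl2 M).

Lemma frob_ge0 n m (A : 'M[C]_(n, m)) : 0 <= frob A.
Proof. by apply: sumr_ge0 => a _; apply: sumr_ge0 => b _; rewrite sqr_ge0. Qed.

Lemma nucl2_ge0 M : 0 <= nucl2 M.
Proof. by rewrite addr_ge0 ?frob_ge0 // mulr_ge0 ?normc_ge0. Qed.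

Lemma nucl_ge0 M : 0 <= nucl M. Proof. exact: sqrtr_ge0. Qed.

Lemma sqr_nucl M : nucl M ^+ 2 = nucl2 M.
Proof. by rewrite sqr_sqrtr ?nucl2_ge0. Qed.

Lemma frob_trmxCl n m (A : 'M[C]_(n, m)) : (frob A)%:C = \tr (A *m A ^t*).
Proof.
rewrite rmorph_sum /=; apply: eq_bigr => a _.
rewrite mxE rmorph_sum /=; apply: eq_bigr => b _.
by rewrite conjmxE mulr_conjc.
Qed.

Lemma frob_trmxC n m (A : 'M[C]_(n, m)) : frob (A ^t*) = frob A.
Proof.
rewrite /frob exchange_big /=; apply: eq_bigr => a _; apply: eq_bigr => b _.
by rewrite conjmxE normc_conjc.
Qed.

Lemma trmxCM n m p (A : 'M[C]_(n, m)) (B : 'M[C]_(m, p)) :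
  (A *m B) ^t* = B ^t* *m A ^t*.
Proof. by rewrite trmx_mul map_mxM. Qed.

Lemma trmxCZ n m (a : C) (A : 'M[C]_(n, m)) : (a *: A) ^t* = conjc a *: A ^t*.
Proof. by apply/matrixP => i j; rewrite !mxE rmorphM. Qed.

Lemma trmxCD n m (A B : 'M[C]_(n, m)) : (A + B) ^t* = A ^t* + B ^t*.
Proof. by apply/matrixP => i j; rewrite !mxE rmorphD. Qed.

Lemma frob_isom n m p (V : 'M[C]_(p, n)) (A : 'M[C]_(n, m)) :
  V ^t* *m V = 1%:M -> frob (V *m A) = frob A.
Proof.
move=> hV; apply: (@complexI R); rewrite !frob_trmxCl trmxCM.
by rewrite mxtrace_mulC !mulmxA -(mulmxA _ _ V) hV mulmx1 mxtrace_mulC.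
Qed.

Lemma unitary_trmxC n (U : 'M[C]_n) : U \is unitarymx -> U ^t* *m U = 1%:M.
Proof. by rewrite -trmxC_unitary => /unitarymxP; rewrite trmxCK. Qed.

Lemma unitaryP n (U : 'M[C]_n) : U ^t* *m U = 1%:M -> U \is unitarymx.
Proof. by move=> h; rewrite -trmxC_unitary; apply/unitarymxP; rewrite trmxCK. Qed.

Lemma unitarymx1 n : (1%:M : 'M[C]_n) \is unitarymx.
Proof. by apply: unitaryP; rewrite trmx1 map_mx1 mulmx1. Qed.

Lemma frob_unitaryl n m (U : 'M[C]_n) (A : 'M[C]_(n, m)) :
  U \is unitarymx -> frob (U *m A) = frob A.
Proof. by move=> hU; rewrite frob_isom // unitary_trmxC. Qed.

Lemma frob_unitaryr n m (U : 'M[C]_n) (A : 'M[C]_(m, n)) :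
  U \is unitarymx -> frob (A *m U) = frob A.
Proof.
by move=> hU; rewrite -frob_trmxC trmxCM frob_unitaryl ?trmxC_unitary // frob_trmxC.
Qed.

Lemma det_trmxC n (U : 'M[C]_n) : \det (U ^t*) = conjc (\det U).
Proof. by rewrite det_map_mx det_tr. Qed.

Lemma normc_det_unitary n (U : 'M[C]_n) : U \is unitarymx -> normc (\det U) = 1.
Proof.
move=> /unitarymxP /(congr1 determinant); rewrite det_mulmx det_trmxC det1 mulr_conjc.
move=> /(@complexI R _ 1) /eqP; rewrite sqrf_eq1 => /orP[/eqP //|/eqP h].
by have := normc_ge0 (\det U); rewrite h oppr_ge0 ler10.
Qed.

Lemma det2 M : \det M = M 0 0 * M 1 1 - M 0 1 * M 1 0.
Proof.
rewrite (expand_det_row _ 0) sum2 /cofactor !det_mx11 !mxE.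
by rewrite lift01 lift10 /= expr0 expr1; ring.
Qed.

Lemma frob2 M : frob M = normc (M 0 0) ^+ 2 + normc (M 0 1) ^+ 2
   + (normc (M 1 0) ^+ 2 + normc (M 1 1) ^+ 2).
Proof. by rewrite /frob !sum2. Qed.

(** With entries [a, b, c, d]: [|ad| <= |det M| + |bc|] and [2 |bc| <= |b| ^ 2 + |c| ^ 2]. *)
Lemma nucl2_diag M : (normc (M 0 0) + normc (M 1 1)) ^+ 2 <= nucl2 M.
Proof.
rewrite /nucl2 frob2 det2.
have := le_normcD (M 0 0 * M 1 1 - M 0 1 * M 1 0) (M 0 1 * M 1 0).
rewrite subrK !ComplexField.Normc.normcM.
have := sqr_ge0 (normc (M 0 1) - normc (M 1 0)).
move: (normc _) (normc _) (normc _) (normc _) (normc _) => a b c d e.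
nra.
Qed.

(** Half of a duality: with unitary invariance it bounds [|tr (G^dagger M)|] for every unitary [G],
    and [nucl_attained] provides equality. *)
Lemma nucl_trace M : normc (\tr M) <= nucl M.
Proof.
rewrite -(@ler_pXn2r _ 2) ?nnegrE ?normc_ge0 ?nucl_ge0 // sqr_nucl.
apply: le_trans (nucl2_diag _).
rewrite /mxtrace sum2.
rewrite ler_pXn2r ?nnegrE ?addr_ge0 ?normc_ge0 //; exact: le_normcD.
Qed.

Lemma nucl2_unitary M (U V : 'M[C]_2) : U \is unitarymx -> V \is unitarymx ->
  nucl2 (U *m M *m V) = nucl2 M.
Proof.
move=> hU hV; rewrite /nucl2 frob_unitaryr // frob_unitaryl // !det_mulmx.
by rewrite !ComplexField.Normc.normcM (normc_det_unitary hU) (normc_det_unitary hV) mulr1 mul1r.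
Qed.

Lemma nucl2_unitaryl M (U : 'M[C]_2) : U \is unitarymx -> nucl2 (U *m M) = nucl2 M.
Proof. by move=> hU; rewrite -[U *m M]mulmx1 nucl2_unitary ?unitarymx1. Qed.

Lemma phase_ex z : exists2 e : C, e * conjc e = 1 & conjc e * z = (normc z)%:C.
Proof.
have [->|z0] := eqVneq z 0.
  by exists 1; rewrite ?conjc1 ?mulr1 // mulr0 ComplexField.Normc.normc0.
have n0 : (normc z)%:C != 0.
  by apply: contra_neq z0 => /(@complexI R _ 0) /ComplexField.Normc.eq0_normc.
exists (z / (normc z)%:C); rewrite conjcM conjc_inv conjc_real; last first.
  rewrite mulrAC [_^* * z]mulrC mulr_conjc rmorphXn /=; by field.
rewrite mulrACA mulr_conjc rmorphXn /=; by field.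
Qed.

Lemma ord2P (a : 'I_2) : a = 0 \/ a = 1.
Proof. by case: a => -[|[|//]] h; [left|right]; apply/val_inj. Qed.

Lemma adj2 M : [/\ (\adj M) 0 0 = M 1 1, (\adj M) 0 1 = - M 0 1,
  (\adj M) 1 0 = - M 1 0 & (\adj M) 1 1 = M 0 0].
Proof.
by split; rewrite mxE /cofactor /= ?expr0 ?expr1 ?expr2 det_mx11 !mxE ?lift01 ?lift10; ring.
Qed.

(** On the right singular vectors of [M] the two summands have eigenvalues [s ^ 2, s' ^ 2] and
    [s' ^ 2, s ^ 2], so their sum is scalar. *)
Lemma add_trmxC_adj M : M ^t* *m M + \adj M *m (\adj M) ^t* = (frob M)%:C%:M.
Proof.
have [h1 h2 h3 h4] := adj2 M.
have -> : (frob M)%:C = M 0 0 * conjc (M 0 0) + M 0 1 * conjc (M 0 1) +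
    (M 1 0 * conjc (M 1 0) + M 1 1 * conjc (M 1 1)).
  by rewrite frob2 !rmorphD /= -!mulr_conjc.
apply/matrixP => a b.
case: (ord2P a) => ->; case: (ord2P b) => ->;
rewrite mxE [X in X + _]mxE [X in _ + X]mxE !sum2 !conjmxE
 ?h1 ?h2 ?h3 ?h4 ?conjcN ![_%:M _ _]mxE /= ?mulr1n ?mulr0n; ring.
Qed.

(* With [e] the phase of [det M], [M + e (adj M)^dagger] is [nucl M] times a unitary. *)
Lemma nucl_attained M : exists2 G, G \is unitarymx & \tr (G ^t* *m M) = (nucl M)%:C.
Proof.
have [M0|M0] := eqVneq (nucl M) 0.
  exists 1%:M; first exact: unitarymx1.
  suff -> : M = 0 by rewrite mulmx0 mxtrace0 /nucl /nucl2 frob2 det2 !mxE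
    !(mul0r, subrr, ComplexField.Normc.normc0, expr0n, addr0, mulr0, sqrtr0).
  have : frob M <= 0.
    rewrite -[X in _ <= X](expr0n _ 2) -[X in X ^+ _]M0 sqr_nucl lerDl.
    by rewrite mulr_ge0 ?normc_ge0.
  rewrite frob2 => h; apply/matrixP => a b; rewrite mxE.
  apply: ComplexField.Normc.eq0_normc; apply/eqP; rewrite -sqrf_eq0.
  have := (sqr_ge0 (normc (M 0 0)), sqr_ge0 (normc (M 0 1)),
    sqr_ge0 (normc (M 1 0)), sqr_ge0 (normc (M 1 1))).
  move=> [] [] [] h1 h2 h3 h4.
  by case: (ord2P a) => ->; case: (ord2P b) => ->; apply/eqP; lra.
have [e e1 e2] := phase_ex (\det M).
pose K := M + e *: (\adj M) ^t*.
have KE : K ^t* = M ^t* + conjc e *: \adj M.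
  by rewrite trmxCD trmxCZ trmxCK.
(* Here [K^dagger M = M^dagger M + |det M|]; trading [M^dagger M] for the adjugate by
   [add_trmxC_adj] lets the adjugate cancel in [K^dagger K]. *)
have hK : K ^t* *m M = ((nucl M) ^+2)%:C%:M - \adj M *m (\adj M)^t* +
    (normc (\det M))%:C%:M - (normc (\det M) *+ 2)%:C%:M.
  rewrite KE mulmxDl -scalemxAl mul_adj_mx scale_scalar_mx e2.
  rewrite sqr_nucl /nucl2 [in RHS]rmorphD raddfD /= -add_trmxC_adj mulr_natl.
  by rewrite [X in X - _ + _]addrAC addrK addrAC addrK.
have hKK : K ^t* *m K = ((nucl M) ^+2)%:C%:M.
  rewrite {2}/K mulmxDr hK KE -scalemxAr mulmxDl -trmxCM mul_adj_mx.
  rewrite -!scalemxAl scalerDr scalerA e1 scale1r.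
  rewrite tr_scalar_mx map_scalar_mx scale_scalar_mx.
  have -> : (e * (\det M) ^* )%R = (normc (\det M))%:C.
    by rewrite -[LHS]conjcK conjcM conjcK e2 conjc_real.
  rewrite mulr2n rmorphD raddfD /=.
  apply/matrixP => a b; rewrite !mxE; ring.
have nC : (nucl M)%:C != 0 by apply: contra_neq M0 => /(@complexI R _ 0).
exists ((nucl M)%:C^-1 *: K).
  apply: unitaryP; rewrite trmxCZ -scalemxAl -scalemxAr hKK.
  rewrite conjc_inv conjc_real scalerA scale_scalar_mx rmorphXn /=.
  by congr (_%:M); field.
rewrite trmxCZ -scalemxAl mxtraceZ KE mulmxDl -scalemxAl.
rewrite mul_adj_mx scale_scalar_mx e2 mxtraceD mxtrace_scalar mxtrace_mulC -frob_trmxCl.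
rewrite conjc_inv conjc_real -rmorphMn -rmorphD /= -mulr_natl -/(nucl2 M) -sqr_nucl rmorphXn /=.
by field.
Qed.

End TwoByTwo.

(** * Takagi's factorisation and the nuclear norm under congruence *)

Section Takagi.
Variable R : realType.
Local Notation C := R[i].
Local Notation normc := (@ComplexField.Normc.normc R).
Implicit Types (M S : 'M[C]_2).

Lemma conjmxZ n m (a : C) (A : 'M[C]_(n, m)) : cj (a *: A) = conjc a *: cj A.
Proof. by apply/matrixP => i j; rewrite !mxE rmorphM. Qed.

Lemma conjmxM n m p (A : 'M[C]_(n, m)) (B : 'M[C]_(m, p)) : cj (A *m B) = cj A *m cj B.
Proof. exact: map_mxM. Qed.

Lemma frob_gt0 n m (A : 'M[C]_(n, m)) : A != 0 -> 0 < frob A.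
Proof.
move=> A0; rewrite lt_neqAle frob_ge0 andbT; apply: contra_neq A0 => /esym/eqP.
rewrite psumr_eq0 => [/allP h|a _]; last by apply: sumr_ge0 => b _; rewrite sqr_ge0.
apply/matrixP => a b; have := h a (mem_index_enum _).
rewrite psumr_eq0 => [/allP/(_ b (mem_index_enum _))|c _]; last by rewrite sqr_ge0.
by rewrite sqrf_eq0 mxE => /eqP /ComplexField.Normc.eq0_normc.
Qed.

Lemma frob_row n (x : 'rV[C]_n) : x *m x ^t* = (frob x)%:C%:M.
Proof. by rewrite [LHS]mx11_scalar frob_trmxCl /mxtrace big_ord1. Qed.

(* Takagi's trick: if [x] is an eigenvector of [S S^*] for [s ^ 2], then
   [conj (x S) + s x] or [i x] is a coneigenvector. *)
Lemma coneigenvector S : S^T = S ->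
  exists2 u : 'rV[C]_2, u != 0 &
    exists s : R, u *m S = s%:C *: cj u.
Proof.
move=> symS.
have [l /eigenvalueP[x xl x0]] := eigenvalue_closed (S *m cj S) isT.
have conjK n m (A : 'M[C]_(n, m)) : cj (cj A) = A.
  by apply/matrixP => a b; rewrite !mxE conjCK.
have fx := frob_gt0 x0.
have Sdag : S ^t* = cj S by rewrite symS.
pose s := Num.sqrt (frob (x *m S) / frob x).
(* Symmetry makes [cj S] the adjoint of [S], so the eigenvalue is [|x S| ^ 2 / |x| ^ 2], real and
   nonnegative. *)
have lE : l = (s ^+ 2)%:C.
  rewrite sqr_sqrtr ?divr_ge0 ?frob_ge0 //.
  have : (x *m S) *m (x *m S) ^t* = l *: (x *m x ^t*).
    by rewrite trmxCM Sdag mulmxA -(mulmxA x) xl scalemxAl.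
  rewrite !frob_row scale_scalar_mx => /matrixP/(_ 0 0); rewrite !mxE eqxx !mulr1n => h.
  have fx0 : (frob x)%:C != 0 by apply: contra_neq (lt0r_neq0 fx) => /(@complexI R _ 0).
  by apply: (mulIf fx0); rewrite -h -rmorphM /= divfK // lt0r_neq0.
pose y := cj (x *m S) + s%:C *: x.
have yS : y *m S = s%:C *: cj y.
  rewrite mulmxDl map_mxD conjK conjmxZ conjc_real scalerDr scalerA.
  rewrite -scalemxAl addrC; congr (_ + _).
  have -> : cj (x *m S) *m S = cj (x *m S *m cj S) by rewrite [RHS]conjmxM conjK.
  by rewrite -mulmxA xl conjmxZ lE conjc_real -rmorphM.
have [y0|y0] := eqVneq y 0; last by exists y => //; exists s.
have xS : x *m S = - s%:C *: cj x.
  have /eqP := y0; rewrite /y addr_eq0 => /eqP/(congr1 (map_mx Num.conj)).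
  by rewrite conjK map_mxN conjmxZ conjc_real scaleNr.
(* Conjugation changes the sign of [i], which turns the coneigenvalue [- s] into [s]. *)
exists ('i%C *: x); first by rewrite scaler_eq0 negb_or x0 andbT eq_complex /= oner_eq0 andbF.
exists s; rewrite -scalemxAl xS conjmxZ !scalerA; congr (_ *: _).
by rewrite /=; simpc.
Qed.

(** The rows of the unitary are a normalised coneigenvector [u] and a vector orthogonal to it. As
    [u S] is a multiple of [cj u], the off-diagonal entry is a multiple of their vanishing inner
    product. *)
Lemma takagi S : S^T = S ->
  exists2 U : 'M[C]_2, U \is unitarymx & (U *m S *m U^T) 0 1 = 0.
Proof.
move=> symS; have [u u0 [s us]] := coneigenvector symS.
have fu := frob_gt0 u0.
pose r := ((Num.sqrt (frob u))^-1)%:C : C.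
pose V : 'M[C]_2 := \matrix_(a, b) (if a == 0 then u 0 b else
   if b == 0 then - conjc (u 0 1) else conjc (u 0 0)).
have uE : (frob u)%:C = u 0 0 * conjc (u 0 0) + u 0 1 * conjc (u 0 1).
  by rewrite frob_trmxCl /mxtrace big_ord1 mxE sum2 !conjmxE.
have VV : V *m V ^t* = (frob u)%:C%:M.
  rewrite uE; apply/matrixP => a b.
  by case: (ord2P a) => ->; case: (ord2P b) => ->;
     rewrite !mxE sum2 !conjmxE !mxE /= ?conjcN ?conjcK ?mulr1n ?mulr0n; ring.
have rr : r * r * (frob u)%:C = 1.
  by rewrite -!rmorphM /= -expr2 exprVn sqr_sqrtr ?frob_ge0 // mulVf ?lt0r_neq0.
exists (r *: V).
  apply/unitarymxP; rewrite trmxCZ -scalemxAl -scalemxAr VV conjc_real.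
  by rewrite !scale_scalar_mx mulrA rr.
have -> : (r *: V) *m S *m (r *: V)^T = (r * r) *: (V *m S *m V^T).
  by rewrite linearZ /= -!scalemxAl -scalemxAr scalerA.
rewrite mxE; suff -> : (V *m S *m V^T) 0 1 = 0 by rewrite mulr0.
have V0 b : (V *m S) 0 b = s%:C * conjc (u 0 b).
  have /matrixP/(_ 0 b) := us; rewrite !mxE => <-.
  by apply: eq_bigr => c _; rewrite mxE.
by rewrite mxE sum2 !V0 !mxE /=; ring.
Qed.

Lemma nucl_diag_le S (U : 'M[C]_2) : U \is unitarymx ->
  \sum_t normc ((U *m S *m U^T) t t) <= nucl S.
Proof.
move=> hU; rewrite -(@ler_pXn2r _ 2) ?nnegrE ?nucl_ge0 ?sumr_ge0 //; last first.
  by move=> t _; rewrite normc_ge0.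
rewrite sqr_nucl -(nucl2_unitary S hU (_ : U^T \is unitarymx)) ?trmx_unitary //.
by rewrite sum2 nucl2_diag.
Qed.

(** For a diagonal matrix the bound of [nucl_diag_le] is an equality, and Takagi's unitary makes
    [U S U^T] diagonal. *)
Lemma nucl_diag_attained S : S^T = S ->
  exists2 U : 'M[C]_2, U \is unitarymx & (U *m S *m U^T) 0 1 = 0 /\
    nucl S = \sum_t normc ((U *m S *m U^T) t t).
Proof.
move=> symS; have [U hU h01] := takagi symS; exists U => //; split=> //.
rewrite /nucl -(nucl2_unitary S hU (_ : U^T \is unitarymx)) ?trmx_unitary //.
have h10 : (U *m S *m U^T) 1 0 = 0.
  have symD : (U *m S *m U^T)^T = U *m S *m U^T by rewrite !trmx_mul trmxK symS mulmxA.
  by rewrite -h01 -[in LHS]symD mxE.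
rewrite /nucl2 frob2 det2 h01 h10 sum2 ComplexField.Normc.normc0 mul0r subr0.
rewrite ComplexField.Normc.normcM.
set p := normc _; set q := normc _.
rewrite -[RHS]ger0_norm ?addr_ge0 ?normc_ge0 // -sqrtr_sqr; congr Num.sqrt; ring.
Qed.

(* If [S = \sum_a d_a u_a u_a^T] with [u] orthonormal, then the nuclear norm of
   [M S M^T] is at most [\sum_a |d_a| |M u_a| ^ 2]. *)
Lemma nucl_congr_sum n (M : 'I_n -> 'M[C]_2) S : S^T = S ->
  \sum_s (M s) ^t* *m M s = 1%:M ->
  \sum_s nucl (M s *m S *m (M s)^T) <= nucl S.
Proof.
move=> symS hM; have [U hU [h01 ->]] := nucl_diag_attained symS.
set D := U *m S *m U^T in h01 *.
have h10 : D 1 0 = 0.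
  have symD : D^T = D by rewrite !trmx_mul trmxK symS mulmxA.
  by rewrite -h01 -[in LHS]symD mxE.
have SE : S = U ^t* *m D *m (U ^t*)^T.
  rewrite /D !mulmxA unitary_trmxC // mul1mx -mulmxA.
  by rewrite -trmx_mul unitary_trmxC // trmx1 mulmx1.
pose N s := M s *m U ^t*.
have NE s : M s *m S *m (M s)^T = N s *m D *m (N s)^T.
  by rewrite {1}SE trmx_mul !mulmxA.
(* A second Takagi unitary [W] writes the nuclear norm as a sum of terms [|\sum_a Q_ta ^ 2 D_aa|],
   and [W] preserves the lengths of the columns of [N s]. *)
have bound s : nucl (N s *m D *m (N s)^T) <=
    \sum_a normc (D a a) * frob (col a (N s)).
  have symN : (N s *m D *m (N s)^T)^T = N s *m D *m (N s)^T.
    by rewrite -NE !trmx_mul trmxK symS mulmxA.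
  have [W hW [_ ->]] := nucl_diag_attained symN.
  have fW a : frob (col a (N s)) = \sum_t normc ((W *m N s) t a) ^+ 2.
    rewrite -(frob_unitaryl _ hW) /frob; apply: eq_bigr => t _.
    by rewrite big_ord1 !mxE; congr (normc _ ^+ 2); apply: eq_bigr => c _; rewrite mxE.
  under [X in _ <= X]eq_bigr do rewrite fW mulr_sumr.
  rewrite exchange_big /=; apply: ler_sum => t _.
  have -> : W *m (N s *m D *m (N s)^T) *m W^T = (W *m N s) *m D *m (W *m N s)^T.
    by rewrite (trmx_mul W) !mulmxA.
  set Q := W *m N s.
  have -> : (Q *m D *m Q^T) t t = \sum_a Q t a ^+ 2 * D a a.
    by rewrite mxE !sum2 ![(Q *m D) _ _]mxE !sum2 h01 h10 !mxE; ring.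
  apply: le_trans (normc_sum _ _) _; apply: ler_sum => a _.
  by rewrite !ComplexField.Normc.normcM mulrC expr2.
under eq_bigr do rewrite NE.
apply: le_trans (ler_sum _ (fun s _ => bound s)) _.
rewrite exchange_big /=; apply: ler_sum => a _.
rewrite -mulr_sumr -[X in _ <= X]mulr1 ler_wpM2l ?normc_ge0 //.
suff /(@complexI R) -> : (\sum_s frob (col a (N s)))%:C = 1%:C by [].
(* Completeness survives the change of basis; its diagonal says that the squared lengths of the
   [a]-th columns add up to one. *)
have : \sum_s (N s) ^t* *m N s = 1%:M.
  under eq_bigr do rewrite /N trmxCM trmxCK -mulmxA (mulmxA _ (M _)).
  by rewrite -mulmx_sumr -mulmx_suml hM mul1mx; apply/unitarymxP.
move=> /matrixP/(_ a a); rewrite [RHS]mxE eqxx => h; rewrite -[RHS]/(true%:R : C) -h.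
rewrite summxE rmorph_sum; apply: eq_bigr => s _ /=.
rewrite frob_trmxCl mxtrace_mulC /mxtrace big_ord1 !mxE; apply: eq_bigr => c _.
by rewrite !mxE.
Qed.

Lemma normc_det_le M : 2 * normc (\det M) <= frob M.
Proof.
rewrite frob2 det2.
have := le_normcD (M 0 0 * M 1 1) (- (M 0 1 * M 1 0)).
rewrite normcN !ComplexField.Normc.normcM.
have := sqr_ge0 (normc (M 0 1) - normc (M 1 0)).
have := sqr_ge0 (normc (M 0 0) - normc (M 1 1)).
move: (normc _) (normc _) (normc _) (normc _) (normc _) => a b c d e.
nra.
Qed.

(** The trace of the completeness relation gives [\sum_s |M_s|_F ^ 2 = 2], and each term is at least
    [2 |det M_s|]. *)
Lemma normc_det_sum n (M : 'I_n -> 'M[C]_2) :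
  \sum_s (M s) ^t* *m M s = 1%:M -> \sum_s normc (\det (M s)) <= 1.
Proof.
move=> hM; rewrite -(@ler_pM2l _ 2) // mulr_sumr mulr1.
apply: le_trans (ler_sum _ (fun s _ => normc_det_le _)) _.
suff /(@complexI R) -> : (\sum_s frob (M s))%:C = (2%:R : R)%:C by [].
rewrite rmorph_sum /=; under eq_bigr do rewrite frob_trmxCl mxtrace_mulC.
by rewrite -raddf_sum hM /= mxtrace_scalar rmorph_nat.
Qed.

End Takagi.

(** * Slices of three-qubit vectors *)

Section Parties.
Variable R : realType.
Local Notation C := R[i].
Local Notation normc := (@ComplexField.Normc.normc R).
Implicit Types (psi : 'cV[C]_(2 * 2 * 2)).

Lemma sum_mxtens (V : nmodType) m n (F : 'I_(m * n) -> V) :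
  \sum_y F y = \sum_a \sum_b F (mxtens_index (a, b)).
Proof.
rewrite pair_big /= (reindex (@mxtens_index m n)) /=; last first.
  by exists (@mxtens_unindex m n) => y _; rewrite ?mxtens_indexK ?mxtens_unindexK.
by apply: eq_bigr => -[a b].
Qed.

(** Under this reshaping inner products become [tr (A^dagger B)], and maximally entangled vectors
    become unitaries divided by [sqrt 2]. *)
Definition mat2 (phi : 'cV[C]_(2 * 2)) : 'M[C]_2 :=
  \matrix_(a, b) phi (mxtens_index (a, b)) 0.

Definition vec2 (M : 'M[C]_2) : 'cV[C]_(2 * 2) :=
  \col_y M (mxtens_unindex y).1 (mxtens_unindex y).2.

Lemma vec2K : cancel vec2 mat2.
Proof. by move=> M; apply/matrixP => a b; rewrite !mxE mxtens_indexK. Qed.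

Lemma projE n (psi : 'cV[C]_n) a b : proj psi a b = psi a 0 * conjc (psi b 0).
Proof. by rewrite mxE big_ord1 conjmxE. Qed.

Lemma mul_trmxC_vec2 (e phi : 'cV[C]_(2 * 2)) :
  (e ^t* *m phi) 0 0 = \tr ((mat2 e) ^t* *m mat2 phi).
Proof.
rewrite mxE sum_mxtens exchange_big; apply: eq_bigr => b _.
by rewrite mxE; apply: eq_bigr => a _; rewrite !mxE.
Qed.

Lemma max_entangledP (e : 'cV[C]_(2 * 2)) : max_entangled e ->
  mat2 e *m (mat2 e) ^t* = 2^-1%:M.
Proof.
move=> [_ _ <-]; apply/matrixP => s t; rewrite !mxE; apply: eq_bigr => a _.
by rewrite !mxE big_ord1 !mxE.
Qed.

Lemma max_entangled_vec2 (G : 'M[C]_2) : G \is unitarymx ->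
  max_entangled (vec2 (((Num.sqrt 2)^-1)%:C *: G)).
Proof.
move=> hG; set r := (_ ^-1)%:C.
have rr : r * conjc r = 2^-1.
  rewrite conjc_real -rmorphM /= -expr2 exprVn sqr_sqrtr //.
  by rewrite fmorphV rmorph_nat.
have h1 : (r *: G) *m (r *: G) ^t* = 2^-1%:M.
  rewrite trmxCZ -scalemxAl -scalemxAr (unitarymxP hG) scalerA.
  by rewrite scale_scalar_mx mulr1 rr.
have h2 : (r *: G)^T *m cj (r *: G) = 2^-1%:M.
  have hGT : G ^T \is unitarymx by rewrite trmx_unitary.
  have := unitarymxP hGT; rewrite trmxK => h.
  have -> : (r *: G)^T = r *: G^T by rewrite linearZ.
  by rewrite conjmxZ -scalemxAl -scalemxAr h scalerA scale_scalar_mx mulr1 rr.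
split.
- apply/matrixP => a b; rewrite (ord1 a) (ord1 b) mul_trmxC_vec2 vec2K mxtrace_mulC h1.
  by rewrite mxtrace_scalar -[LHS]mulr_natl divff ?pnatr_eq0 // mxE.
- rewrite -h2; apply/matrixP => s t; rewrite !mxE; apply: eq_bigr => a _.
  by rewrite projE !mxE !mxtens_indexK.
- rewrite -h1; apply/matrixP => s t; rewrite !mxE; apply: eq_bigr => a _.
  by rewrite projE !mxE !mxtens_indexK.
Qed.

Lemma expval_proj n (c : R) (phi e : 'cV[C]_n) :
  expval (c%:C *: proj phi) e = c * normc ((e ^t* *m phi) 0 0) ^+ 2.
Proof.
rewrite /expval -scalemxAr -scalemxAl mxE /proj mulmxA -(mulmxA _ _ e).
have -> : phi ^t* *m e = (e ^t* *m phi) ^t* by rewrite trmxCM trmxCK.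
rewrite mxE big_ord1 conjmxE mulr_conjc -rmorphM /=; ring.
Qed.

Lemma sup_max (A : set R) m : A m -> (forall x, A x -> x <= m) -> sup A = m.
Proof.
move=> Am Ale; apply/eqP; rewrite eq_le; apply/andP; split.
  by apply: ge_sup => //; exists m.
by apply: ub_le_sup => //; exists m.
Qed.

(** The overlaps with maximally entangled vectors are [|tr (G^dagger A)| / sqrt 2] with [G] unitary,
    so the largest squared overlap is half the squared nuclear norm. *)
Lemma fef_proj (c : R) (phi : 'cV[C]_(2 * 2)) : 0 <= c ->
  fef (c%:C *: proj phi) = c * (nucl2 (mat2 phi) / 2).
Proof.
move=> c0; apply: sup_max.
  have [G hG hGt] := nucl_attained (mat2 phi).
  exists (vec2 (((Num.sqrt 2)^-1)%:C *: G)); first exact: max_entangled_vec2.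
  rewrite expval_proj mul_trmxC_vec2 vec2K trmxCZ -scalemxAl mxtraceZ hGt conjc_real -rmorphM.
  by congr (_ * _); rewrite normcR real_normK ?num_real // exprMn exprVn sqr_nucl sqr_sqrtr // mulrC.
move=> _ [e he ->]; rewrite expval_proj ler_wpM2l // mul_trmxC_vec2.
set E := mat2 e.
have hU : (Num.sqrt 2)%:C *: E \is unitarymx.
  apply/unitarymxP; rewrite trmxCZ -scalemxAl -scalemxAr (max_entangledP he) scalerA.
  rewrite conjc_real -rmorphM /= -expr2 sqr_sqrtr // scale_scalar_mx rmorph_nat.
  by rewrite divff // pnatr_eq0.
rewrite ler_pdivlMr // -[2](@sqr_sqrtr R) // -exprMn -sqr_nucl.
rewrite ler_pXn2r ?nnegrE ?mulr_ge0 ?normc_ge0 ?nucl_ge0 ?sqrtr_ge0 //.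
have -> : normc (\tr (E ^t* *m mat2 phi)) * Num.sqrt 2 =
    normc (\tr (((Num.sqrt 2)%:C *: E) ^t* *m mat2 phi)).
  rewrite trmxCZ -scalemxAl mxtraceZ conjc_real ComplexField.Normc.normcM normcR.
  by rewrite ger0_norm ?sqrtr_ge0 // mulrC.
apply: le_trans (nucl_trace _) _; rewrite /nucl ler_sqrt ?nucl2_ge0 //.
set W := _ *: E in hU *.
have hW : W ^t* \is unitarymx by rewrite trmxC_unitary.
by rewrite (nucl2_unitaryl _ hW).
Qed.

Lemma party_cases (p : party) : [\/ p = ord0, p = inord 1 | p = ord_max].
Proof.
case: p => -[|[|[|//]]] h; [apply: Or31|apply: Or32|apply: Or33];
  by apply/val_inj; rewrite //= ?inordK.
Qed.

Lemma partyE : ((inord 1 : party) == ord0 = false) *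
 ((ord0 : party) == inord 1 = false) * ((inord 1 : party) == ord_max = false)
 * ((ord_max : party) == inord 1 = false) * ((ord_max : party) == ord0 = false)
 * ((ord0 : party) == ord_max = false).
Proof. by rewrite -!val_eqE /= !inordK. Qed.

Definition upd (x : party -> 'I_2) p a : party -> 'I_2 :=
  fun q => if q == p then a else x q.

Lemma tens3E (N : party -> 'M[C]_2) a b c a' b' c' :
  tens3 N (mxtens_index (mxtens_index (a, b), c)) (mxtens_index (mxtens_index (a', b'), c'))
  = N ord0 a a' * N (inord 1) b b' * N ord_max c c'.
Proof. by rewrite /tens3 !tensmxE. Qed.

Lemma local_opE p (M : 'M[C]_2) psi x :
  (local_op p M *m psi) (cbasis x) 0 =
  \sum_a M (x p) a * psi (cbasis (upd x p a)) 0.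
Proof.
rewrite mxE sum_mxtens sum_mxtens.
under eq_bigr do under eq_bigr do under eq_bigr do rewrite tens3E.
rewrite /cbasis /upd !sum2.
case: (party_cases p) => ->; rewrite ?partyE ?eqxx;
  case: (ord2P (x ord0)) => ->; case: (ord2P (x (inord 1))) => ->;
  case: (ord2P (x ord_max)) => ->; rewrite !mxE /=; ring.
Qed.

Lemma eq_cbasis x y : (forall p, x p = y p) -> cbasis x = cbasis y.
Proof. by move=> h; rewrite /cbasis !h. Qed.

Section Slices.
Variables (i j k : party).
Hypothesis hijk : uniq [:: i; j; k].

Let hij : (i == j) = false.
Proof. by move: hijk; rewrite /= !inE; case: eqP. Qed.
Let hik : (i == k) = false.
Proof. by move: hijk; rewrite /= !inE; case: (i == k); rewrite ?orbT. Qed.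
Let hjk : (j == k) = false.
Proof. by move: hijk; rewrite /= !inE; case: (j == k); rewrite ?andbF. Qed.

Lemma uniq_parties p : [\/ p = i, p = j | p = k].
Proof.
have : p \in [:: i; j; k].
  have := uniq_min_size hijk (_ : {subset [:: i; j; k] <= enum 'I_3}).
  case=> [q _||_ ->]; rewrite ?mem_enum ?size_enum_ord //.
by rewrite !inE => /or3P[] /eqP; [apply: Or31|apply: Or32|apply: Or33].
Qed.

Lemma assign1 a b c : assign i j k a b c i = a.
Proof. by rewrite /assign eqxx. Qed.
Lemma assign2 a b c : assign i j k a b c j = b.
Proof. by rewrite /assign eq_sym hij eqxx. Qed.
Lemma assign3 a b c : assign i j k a b c k = c.
Proof. by rewrite /assign ![k == _]eq_sym hik hjk. Qed.

Lemma assign_eta x : cbasis x = cbasis (assign i j k (x i) (x j) (x k)).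
Proof.
apply: eq_cbasis => p.
by case: (uniq_parties p) => ->; rewrite ?assign1 ?assign2 ?assign3.
Qed.

Definition slice psi (c : 'I_2) : 'M[C]_2 :=
  \matrix_(a, b) psi (cbasis (assign i j k a b c)) 0.

Lemma slice_local1 M psi c : slice (local_op i M *m psi) c = M *m slice psi c.
Proof.
apply/matrixP => a b; rewrite mxE local_opE assign1 mxE; apply: eq_bigr => d _.
by rewrite mxE assign_eta /upd eqxx ![_ == i]eq_sym hij hik assign2 assign3.
Qed.

Lemma slice_local2 M psi c : slice (local_op j M *m psi) c = slice psi c *m M^T.
Proof.
apply/matrixP => a b; rewrite mxE local_opE assign2 mxE; apply: eq_bigr => d _.
by rewrite !mxE mulrC assign_eta /upd eqxx hij ![_ == j]eq_sym hjk assign1 assign3.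
Qed.

Lemma slice_local3 M psi c :
  slice (local_op k M *m psi) c = \sum_d M c d *: slice psi d.
Proof.
apply/matrixP => a b; rewrite mxE local_opE assign3 summxE; apply: eq_bigr => d _.
by rewrite !mxE assign_eta /upd eqxx hik hjk assign1 assign2.
Qed.

(* The quadratic form [det (\sum_c x_c slice_c)] as a symmetric matrix. *)
Definition tform psi : 'M[C]_2 := \matrix_(c, d)
  ((slice psi c 0 0 * slice psi d 1 1 + slice psi d 0 0 * slice psi c 1 1
    - slice psi c 0 1 * slice psi d 1 0 - slice psi d 0 1 * slice psi c 1 0) / 2).

Lemma tformE psi c d : tform psi c d =
  (slice psi c 0 0 * slice psi d 1 1 + slice psi d 0 0 * slice psi c 1 1
    - slice psi c 0 1 * slice psi d 1 0 - slice psi d 0 1 * slice psi c 1 0) / 2.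
Proof. by rewrite mxE. Qed.

Lemma tform_sym psi : (tform psi)^T = tform psi.
Proof. by apply/matrixP => c d; rewrite !mxE; congr (_ / _); ring. Qed.

Lemma det_slices psi (U : 'M[C]_2) t :
  \det (\sum_d U t d *: slice psi d) = (U *m tform psi *m U^T) t t.
Proof.
have e a b : (\sum_d U t d *: slice psi d) a b =
    U t 0 * slice psi 0 a b + U t 1 * slice psi 1 a b.
  by rewrite summxE sum2 [X in X + _]mxE [X in _ + X]mxE.
rewrite det2 !e [RHS]mxE sum2 ![(U *m _) _ _]mxE !sum2 ![U^T _ _]mxE !tformE.
by field.
Qed.

(** An operator on [i] multiplies every slice from the left, hence every determinant of the pencil
    by [\det M]. *)
Lemma tform_local1 M psi : tform (local_op i M *m psi) = \det M *: tform psi.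
Proof.
apply/matrixP => c d; rewrite [RHS]mxE !tformE det2 !slice_local1.
by rewrite ![(M *m _) _ _]mxE !sum2; field.
Qed.

Lemma tform_local2 M psi : tform (local_op j M *m psi) = \det M *: tform psi.
Proof.
apply/matrixP => c d; rewrite [RHS]mxE !tformE det2 !slice_local2.
by rewrite ![(_ *m M^T) _ _]mxE !sum2 ![M^T _ _]mxE; field.
Qed.

Lemma tform_local3 M psi : tform (local_op k M *m psi) = M *m tform psi *m M^T.
Proof.
have e a c b : slice (local_op k M *m psi) c a b =
    M c 0 * slice psi 0 a b + M c 1 * slice psi 1 a b.
  by rewrite slice_local3 summxE sum2 [X in X + _]mxE [X in _ + X]mxE.
apply/matrixP => c d; rewrite tformE !e.
rewrite [RHS]mxE sum2 ![(M *m _) _ _]mxE !sum2 ![M^T _ _]mxE.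
by rewrite !tformE; field.
Qed.

End Slices.
End Parties.

(** * Teleportation capacity of a pure state in closed form *)

Section Teleportation.
Variable R : realType.
Local Notation C := R[i].
Local Notation normc := (@ComplexField.Normc.normc R).
Implicit Types (psi : 'cV[C]_(2 * 2 * 2)).
Variables (i j k : party).
Hypothesis hijk : uniq [:: i; j; k].

Local Notation slice := (@slice R i j k).
Local Notation tform := (@tform R i j k).

Lemma sum_cbasis (F : 'I_(2 * 2 * 2) -> R) :
  \sum_y F y = \sum_a \sum_b \sum_c F (cbasis (assign i j k a b c)).
Proof.
rewrite !sum_mxtens !sum2 /cbasis /assign; move: hijk.
case: (party_cases i) => ->; case: (party_cases j) => ->; case: (party_cases k) => ->;
  rewrite ?cons_uniq ?in_cons ?eqxx ?partyE ?orbT //= => _; ring.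
Qed.

Lemma frob_slices psi : frob psi = \sum_c frob (slice psi c).
Proof.
rewrite /frob; under eq_bigr do rewrite big_ord1.
rewrite sum_cbasis !sum2 !mxE; ring.
Qed.

(** The unnormalised amplitudes of [i, j] after outcome [t]. *)
Definition meas_slice (U : 'M[C]_2) psi t : 'M[C]_2 := \sum_c U t c *: slice psi c.

Lemma meas_sliceE U psi t a b :
  meas_slice U psi t a b = \sum_c U t c * psi (cbasis (assign i j k a b c)) 0.
Proof. by rewrite summxE; apply: eq_bigr => c _; rewrite !mxE. Qed.

Lemma meas_probE U psi t : meas_prob i j k U (proj psi) t = frob (meas_slice U psi t).
Proof.
rewrite /meas_prob /expval /ket.
have -> (M : 'M[C]_2) :
    ((delta_mx t 0 : 'cV[C]_2) ^t* *m M *m (delta_mx t 0 : 'cV[C]_2)) 0 0 = M t t.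
  have -> : (delta_mx t 0 : 'cV[C]_2) ^t* = delta_mx 0 t.
    by apply/matrixP => a b; rewrite !mxE andbC; case: (_ && _); rewrite ?rmorph0 ?rmorph1.
  by rewrite -rowE -colE !mxE.
suff -> : (U *m reduced1 i j k (proj psi) *m U ^t*) t t = (frob (meas_slice U psi t))%:C by [].
rewrite /frob !sum2 !rmorphD /= -!mulr_conjc !meas_sliceE [LHS]mxE !sum2 !conjmxE.
rewrite !mxE !sum2 !mxE !sum2 !projE !conjcD !conjcM; ring.
Qed.

(** For fixed bits of [i] and [j], [U] acts on the pair of amplitudes along [k] and preserves its
    length. *)
Lemma sum_frob_meas_slice U psi : U \is unitarymx ->
  \sum_t frob (meas_slice U psi t) = frob psi.
Proof.
move=> hU; rewrite frob_slices.
transitivity (\sum_a \sum_b frob (U *m \col_c slice psi c a b)).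
  rewrite exchange_big /=; apply: eq_bigr => a _.
  rewrite exchange_big /=; apply: eq_bigr => b _.
  apply: eq_bigr => t _; rewrite big_ord1 meas_sliceE [in RHS]mxE.
  by congr (normc _ ^+ 2); apply: eq_bigr => c _; rewrite !mxE.
under eq_bigr do under eq_bigr do rewrite frob_unitaryl //.
rewrite /frob !sum2 !big_ord1 !mxE; ring.
Qed.

Lemma reduced2_proj psi :
  reduced2 i j k (proj psi) = \sum_c proj (vec2 (slice psi c)).
Proof.
by apply/matrixP => x y; rewrite mxE summxE; apply: eq_bigr => c _; rewrite !projE !mxE.
Qed.

Lemma proj_mul n m (A : 'M[C]_(m, n)) (phi : 'cV[C]_n) :
  A *m proj phi *m A ^t* = proj (A *m phi).
Proof. by rewrite /proj trmxCM !mulmxA. Qed.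

Lemma proj_scale n (a : C) (phi : 'cV[C]_n) :
  proj (a *: phi) = (normc a ^+ 2)%:C *: proj phi.
Proof. by rewrite /proj trmxCZ -scalemxAl -scalemxAr scalerA mulr_conjc. Qed.

(** After the projection every slice along [k] is [meas_slice U psi t] times [conjc (U t c)], and
    these factors have squared moduli summing to one. *)
Lemma meas_stateE U psi t : U \is unitarymx ->
  meas_state i j k U (proj psi) t =
  ((frob (meas_slice U psi t))^-1)%:C *: proj (vec2 (meas_slice U psi t)).
Proof.
move=> hU; rewrite /meas_state meas_probE; congr (_ *: _).
rewrite proj_mul reduced2_proj.
have vE d : (U ^t* *m ket R t) d 0 = conjc (U t d).
  by rewrite /ket -colE mxE conjmxE.
have sE c : slice (local_op k (proj (U ^t* *m ket R t)) *m psi) c =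
    conjc (U t c) *: meas_slice U psi t.
  rewrite slice_local3 // scaler_sumr; apply: eq_bigr => d _.
  by rewrite scalerA projE !vE conjcK.
have vZ a M : vec2 (a *: M) = a *: vec2 M :> 'cV[C]__.
  by apply/matrixP => x y; rewrite !mxE.
under eq_bigr do rewrite sE vZ proj_scale normc_conjc.
rewrite -scaler_suml -rmorph_sum /=.
suff -> : \sum_c normc (U t c) ^+ 2 = 1 by rewrite scale1r.
have /unitarymxP/matrixP/(_ t t) := hU; rewrite !mxE eqxx => h.
apply: (@complexI R); rewrite -[RHS]h rmorph_sum /=; apply: eq_bigr => c _.
by rewrite -mulr_conjc !mxE.
Qed.

Lemma meas_fef U psi t : U \is unitarymx ->
  meas_prob i j k U (proj psi) t * fef (meas_state i j k U (proj psi) t) =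
  frob (meas_slice U psi t) / 2 + normc ((U *m tform psi *m U^T) t t).
Proof.
move=> hU; rewrite meas_stateE // meas_probE fef_proj ?invr_ge0 ?frob_ge0 // vec2K.
rewrite -det_slices // -/(meas_slice U psi t).
set M := meas_slice U psi t.
(* An outcome of probability zero contributes zero on the left; on the right [normc_det_le] makes
   the determinant vanish too. *)
have [f0|f0] := eqVneq (frob M) 0; last by rewrite mulVKf // /nucl2; field.
rewrite f0 !mul0r; have := normc_det_le M; have := normc_ge0 (\det M); rewrite f0; lra.
Qed.

(* Half the closed formula [T_ij = sqrt (C_ij ^ 2 + tau)]: the singular values
   [s, s'] of [tform psi] satisfy [C_ij = 2 |s - s'|] and [tau = 16 s s']. *)
Definition cap psi : R := nucl (tform psi).

(** By normalisation the terms [frob / 2] add up to one half for every [U], so only the diagonal of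
    [U S U^T] is maximised. *)
Lemma tele_capE psi : frob psi = 1 -> tele_cap i j k psi = 2 * cap psi.
Proof.
move=> psi1.
suff h : tele_fef i j k (proj psi) = 2^-1 + cap psi.
  by rewrite /tele_cap /tele_fidelity h; field.
have sumE (U : 'M[C]_2) : U \is unitarymx ->
    \sum_t meas_prob i j k U (proj psi) t * fef (meas_state i j k U (proj psi) t) =
    2^-1 + \sum_t normc ((U *m tform psi *m U^T) t t).
  move=> hU; under eq_bigr do rewrite meas_fef //.
  by rewrite big_split /= -mulr_suml sum_frob_meas_slice // psi1 mul1r.
apply: sup_max => [|_ [U hU ->]].
  have [U hU [_ h]] := nucl_diag_attained (tform_sym i j k psi).
  by exists U => //; rewrite sumE // /cap h.
by rewrite sumE // lerD2l nucl_diag_le.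
Qed.

Lemma cap_ge0 psi : 0 <= cap psi. Proof. exact: nucl_ge0. Qed.

Lemma nuclZ (a : C) (M : 'M[C]_2) : nucl (a *: M) = normc a * nucl M.
Proof.
apply/eqP; rewrite -(@eqrXn2 _ 2) ?nucl_ge0 ?mulr_ge0 ?nucl_ge0 ?normc_ge0 //.
rewrite exprMn !sqr_nucl /nucl2 !frob2 !det2 !mxE.
have -> : a * M 0 0 * (a * M 1 1) - a * M 0 1 * (a * M 1 0) =
  a ^+ 2 * (M 0 0 * M 1 1 - M 0 1 * M 1 0) by ring.
by rewrite !ComplexField.Normc.normcM; apply/eqP; ring.
Qed.

Lemma capZ (a : R) psi : 0 <= a -> cap (a%:C *: psi) = a ^+ 2 * cap psi.
Proof.
move=> a0; rewrite /cap.
have -> : tform (a%:C *: psi) = (a ^+ 2)%:C *: tform psi.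
  by apply/matrixP => c d; rewrite [RHS]mxE !tformE !mxE rmorphXn /=; field.
by rewrite nuclZ normcR ger0_norm ?exprn_ge0.
Qed.

(** For [i] and [j] the factors [|det (M s)|] sum to at most one; for [k] the form changes by
    congruence and [nucl_congr_sum] applies. *)
Lemma cap_local_sum (p : party) n (M : 'I_n -> 'M[C]_2) psi :
  \sum_s (M s) ^t* *m M s = 1%:M ->
  \sum_s cap (local_op p (M s) *m psi) <= cap psi.
Proof.
move=> hM; have hdet := normc_det_sum hM.
case: (uniq_parties hijk p) => ->.
- under eq_bigr do rewrite /cap tform_local1 // nuclZ.
  by rewrite -mulr_suml -[X in _ <= X]mul1r ler_wpM2r ?nucl_ge0.
- under eq_bigr do rewrite /cap tform_local2 // nuclZ.
  by rewrite -mulr_suml -[X in _ <= X]mul1r ler_wpM2r ?nucl_ge0.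
- under eq_bigr do rewrite /cap tform_local3 //.
  by apply: nucl_congr_sum => //; exact: tform_sym.
Qed.

End Teleportation.

(** * Vanishing capacity and biseparable vectors *)

Section Biseparability.
Variable R : realType.
Local Notation C := R[i].
Implicit Types (psi : 'cV[C]_(2 * 2 * 2)).

Lemma nucl_eq0 (M : 'M[C]_2) : (nucl M == 0) = (M == 0).
Proof.
apply/eqP/eqP => [M0|->]; last first.
  by rewrite -(scale0r (0 : 'M[C]_2)) nuclZ ComplexField.Normc.normc0 mul0r.
apply: contra_eq M0 => /frob_gt0 f0.
rewrite sqrtr_eq0 -ltNge; apply: lt_le_trans f0 _.
by rewrite lerDl mulr_ge0 ?normc_ge0.
Qed.

Lemma rank1_factor (M : 'M[C]_2) : \det M = 0 ->
  exists x y : 'I_2 -> C, forall a b, M a b = x a * y b.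
Proof.
rewrite det2 => /eqP; rewrite subr_eq0 => /eqP d0.
have [h0|h0] := eqVneq (M 0 0) 0; have [h1|h1] := eqVneq (M 0 1) 0.
- exists (fun a => (a == 1)%:R), (M 1) => a b.
  by case: (ord2P a) => ->; rewrite /= ?mul1r ?mul0r //; case: (ord2P b) => ->.
- exists (fun a => M a 1 / M 0 1), (M 0) => a b.
  case: (ord2P a) => ->; case: (ord2P b) => ->; rewrite ?h0 ?mulr0 ?divff ?mul1r ?divfK //.
  by move: d0; rewrite h0 mul0r => /esym/eqP; rewrite mulf_eq0 (negPf h1) => /eqP.
- exists (fun a => M a 0 / M 0 0), (M 0) => a b.
  case: (ord2P a) => ->; case: (ord2P b) => ->; rewrite ?h1 ?mulr0 ?divff ?mul1r ?divfK //.
  by move: d0; rewrite h1 mul0r => /eqP; rewrite mulf_eq0 (negPf h0) => /eqP.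
- exists (fun a => M a 0 / M 0 0), (M 0) => a b.
  case: (ord2P a) => ->; case: (ord2P b) => ->; rewrite ?divff ?mul1r ?divfK //.
  by apply: (mulfI h0); rewrite d0; field.
Qed.

(** A zero vector is parallel to anything, so the common direction is [z] if [x] vanishes and [x]
    otherwise. *)
Lemma parallel2 (x z : 'I_2 -> C) : x 0 * z 1 = x 1 * z 0 ->
  exists v l m, (forall a, x a = l * v a) /\ (forall a, z a = m * v a).
Proof.
move=> h; have [h0|h0] := eqVneq (x 0) 0; have [h1|h1] := eqVneq (x 1) 0.
- exists z, 0, 1; split=> a; rewrite ?mul1r ?mul0r //.
  by case: (ord2P a) => ->.
- exists x, 1, (z 1 / x 1); split=> a; rewrite ?mul1r //.
  case: (ord2P a) => ->; rewrite ?divfK // h0 mulr0.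
  by move: h; rewrite h0 mul0r => /esym/eqP; rewrite mulf_eq0 (negPf h1) => /eqP.
- exists x, 1, (z 0 / x 0); split=> a; rewrite ?mul1r //.
  case: (ord2P a) => ->; rewrite ?divfK // h1 mulr0.
  by move: h; rewrite h1 mul0r => /eqP; rewrite mulf_eq0 (negPf h0) => /eqP.
- exists x, 1, (z 0 / x 0); split=> a; rewrite ?mul1r //.
  case: (ord2P a) => ->; rewrite ?divfK //.
  by apply: (mulfI h0); rewrite h; field.
Qed.

(** The zero diagonal of [S] makes both slices of rank one, [x y^T] and [z w^T]; then [2 S_01] is
    the product of the determinants of the pairs [x, z] and [y, w]. If the first vanishes [i] splits
    off, if the second does, [j]. *)
Lemma cap_eq0_biseparable (i j k : party) psi : uniq [:: i; j; k] ->
  cap i j k psi = 0 -> biseparable_pure psi.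
Proof.
move=> hijk /eqP; rewrite nucl_eq0 => /eqP S0.
have Scd c d : tform i j k psi c d = 0 by rewrite S0 mxE.
have det0 c : \det (slice i j k psi c) = 0.
  by rewrite -(Scd c c) tformE det2; field.
have [x [y Axy]] := rank1_factor (det0 0).
have [z [w Bzw]] := rank1_factor (det0 1).
have : (x 0 * z 1 - x 1 * z 0) * (y 0 * w 1 - y 1 * w 0) = 0.
  transitivity (2 * tform i j k psi 0 1); last by rewrite Scd mulr0.
  by rewrite tformE !Axy !Bzw; field.
move/eqP; rewrite mulf_eq0 !subr_eq0 => /orP[] /eqP /parallel2 [v [l [m [hl hm]]]].
- exists i, j, k; split=> //.
  exists (\col_s v s), (\col_q (if (mxtens_unindex q).2 == 0
     then l * y (mxtens_unindex q).1 else m * w (mxtens_unindex q).1)) => s t u.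
  rewrite !mxE mxtens_indexK /=.
  have -> : psi (cbasis (assign i j k s t u)) 0 = slice i j k psi u s t by rewrite mxE.
  by case: (ord2P u) => ->; rewrite ?Axy ?Bzw ?hl ?hm /=; ring.
- have hjik : uniq [:: j; i; k].
    move: hijk; rewrite /= !inE !negb_or => /and3P[/andP[ij ik] jk _].
    by rewrite eq_sym ij ik jk.
  exists j, i, k; split=> //.
  exists (\col_s v s), (\col_q (if (mxtens_unindex q).2 == 0
     then l * x (mxtens_unindex q).1 else m * z (mxtens_unindex q).1)) => s t u.
  rewrite (assign_eta hijk) assign2 // assign1 assign3 //.
  rewrite !mxE mxtens_indexK /=.
  have -> : psi (cbasis (assign i j k t s u)) 0 = slice i j k psi u t s by rewrite mxE.
  by case: (ord2P u) => ->; rewrite ?Axy ?Bzw ?hl ?hm /=; ring.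
Qed.

(** As [p] is [i] or [j], all columns, or all rows, of both slices are multiples of one vector, so
    the pencil is singular everywhere. *)
Lemma cap_factor_eq0 (i j k p : party) psi (al : 'I_2 -> C) (be : (party -> 'I_2) -> C) :
  uniq [:: i; j; k] -> p != k ->
  (forall x a, be (upd x p a) = be x) ->
  (forall x, psi (cbasis x) 0 = al (x p) * be x) ->
  cap i j k psi = 0.
Proof.
move=> hijk pk bep hpsi; apply/eqP; rewrite nucl_eq0; apply/eqP/matrixP => c d.
rewrite tformE !mxE !hpsi.
case: (uniq_parties hijk p) pk bep => -> pk bep; last by rewrite eqxx in pk.
- rewrite !assign1.
  (* Since [be] ignores the bit of [p], resetting that bit makes the factors agree literally. *)
  have e a b e : be (assign i j k a b e) = be (upd (assign i j k 0 b e) i a).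
    by congr be; apply/funext => q; rewrite /upd /assign; case: eqP.
  rewrite ![be (assign _ _ _ 1 _ _)]e !bep; by field.
- rewrite !(assign2 hijk).
  have e a b e : be (assign i j k a b e) = be (upd (assign i j k a 0 e) j b).
    congr be; apply/funext => q; rewrite /upd.
    have [->|qj] := eqVneq q j; first by rewrite (assign2 hijk).
    by rewrite /assign (negPf qj).
  rewrite ![be (assign _ _ _ _ 1 _)]e !bep; by field.
Qed.

(** The party that splits off differs from [k] or from [j]; the capacity in which that one is
    measured vanishes. *)
Lemma biseparable_cap_eq0 (i j k : party) psi : uniq [:: i; j; k] ->
  biseparable_pure psi -> cap i j k psi = 0 \/ cap i k j psi = 0.
Proof.
move=> hijk [p [q [r [hpqr [a [b hab]]]]]].
have hikj : uniq [:: i; k; j].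
  move: hijk; rewrite /= !inE !negb_or => /and3P[/andP[ij ik] jk _].
  by rewrite ij ik eq_sym jk.
pose be (x : party -> 'I_2) := b (mxtens_index (x q, x r)) 0.
have hpsi x : psi (cbasis x) 0 = a (x p) 0 * be x.
  by rewrite (assign_eta hpqr) hab.
have hbe x c : be (upd x p c) = be x.
  move: hpqr; rewrite /= !inE negb_or => /and3P[/andP[pq pr] _ _].
  by rewrite /be /upd ![_ == p]eq_sym (negPf pq) (negPf pr).
have [pk|pk] := eqVneq p k; last first.
  by left; exact: (cap_factor_eq0 (al := fun s => a s 0) hijk pk hbe hpsi).
right; apply: (cap_factor_eq0 (al := fun s => a s 0) hikj _ hbe hpsi).
by rewrite pk; move: hikj; rewrite /= !inE => /and3P[].
Qed.

Lemma unit_vectorE n (phi : 'cV[C]_n) : unit_vector phi <-> frob phi = 1.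
Proof.
rewrite /unit_vector [_ *m _]mx11_scalar.
have -> : (phi ^t* *m phi) 0 0 = (frob phi)%:C.
  by rewrite frob_trmxCl mxtrace_mulC /mxtrace big_ord1.
split=> [/matrixP/(_ 0 0)|->] //; rewrite !mxE eqxx !mulr1n => h.
exact: (@complexI R).
Qed.

End Biseparability.

(** * Convex roofs of unnormalised states *)

Section Psd.
Variable R : realType.
Local Notation C := R[i].

Definition psd n (rho : 'M[C]_n) : Prop :=
  rho ^t* = rho /\ forall v : 'cV[C]_n, 0 <= (v ^t* *m rho *m v) 0 0.

Lemma density_psd n (rho : 'M[C]_n) : density rho -> psd rho.
Proof. by case. Qed.

Lemma psd_density n (rho : 'M[C]_n) : psd rho -> \tr rho = 1 -> density rho.
Proof. by case. Qed.

Lemma psd0 n : psd (0 : 'M[C]_n).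
Proof.
split=> [|v]; first by apply/matrixP => a b; rewrite !mxE rmorph0.
by rewrite mulmx0 mul0mx mxE.
Qed.

Lemma psdD n (A B : 'M[C]_n) : psd A -> psd B -> psd (A + B).
Proof.
move=> [hA pA] [hB pB]; split=> [|v]; first by rewrite trmxCD hA hB.
by rewrite mulmxDr mulmxDl mxE addr_ge0.
Qed.

Lemma psd_sum n (I : Type) (r : seq I) (P : pred I) (A : I -> 'M[C]_n) :
  (forall l, psd (A l)) -> psd (\sum_(l <- r | P l) A l).
Proof. by move=> hA; elim/big_ind: _ => [|X Y|l _]; [exact: psd0|exact: psdD|]. Qed.

Lemma psdZ n (c : R) (A : 'M[C]_n) : 0 <= c -> psd A -> psd (c%:C *: A).
Proof.
move=> c0 [hA pA]; split=> [|v]; first by rewrite trmxCZ hA conjc_real.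
by rewrite -scalemxAr -scalemxAl mxE mulr_ge0 // ler0c.
Qed.

Lemma psd_congr n m (M : 'M[C]_(m, n)) (A : 'M[C]_n) : psd A -> psd (M *m A *m M ^t*).
Proof.
move=> [hA pA]; split=> [|v]; first by rewrite !trmxCM trmxCK hA mulmxA.
by have := pA (M ^t* *m v); rewrite trmxCM trmxCK !mulmxA.
Qed.

Lemma tr_proj n (phi : 'cV[C]_n) : \tr (proj phi) = (frob phi)%:C.
Proof. by rewrite frob_trmxCl. Qed.

Lemma psd_trace_ge0 n (A : 'M[C]_n) : psd A -> 0 <= \tr A.
Proof.
move=> [_ pA]; apply: sumr_ge0 => a _.
have := pA (delta_mx a 0).
suff -> : ((delta_mx a 0 : 'cV[C]_n) ^t* *m A *m (delta_mx a 0 : 'cV[C]_n)) 0 0 = A a a by [].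
have -> : (delta_mx a 0 : 'cV[C]_n) ^t* = delta_mx 0 a.
  by apply/matrixP => x y; rewrite !mxE andbC; case: (_ && _); rewrite ?rmorph0 ?rmorph1.
by rewrite -rowE -colE !mxE.
Qed.

(** Spectral theorem, each eigenvector being scaled by the root of its eigenvalue so that no weights
    remain. *)
Lemma psd_decomposition n (A : 'M[C]_n) : psd A ->
  exists s : seq 'cV[C]_n, A = \sum_(phi <- s) proj phi.
Proof.
move=> [hA pA].
have /orthomx_spectralP : A \is normalmx by apply/normalmxP; rewrite hA.
set P := spectralmx A; set d := spectral_diag A => AE.
have uP : P \is unitarymx := spectral_unitarymx A.
have {}AE : A = P ^t* *m diag_mx d *m P by rewrite {1}AE invmx_unitary.
pose v l := (row l P) ^t*.
have AE' : A = \sum_l d 0 l *: proj (v l).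
  apply/matrixP => a b; rewrite AE mxE summxE; apply: eq_bigr => l _.
  rewrite [RHS]mxE projE !conjmxE conjcK mul_mx_diag !mxE.
  rewrite -[(_ ^*)%R]/(conjc _); ring.
have d0 l : 0 <= d 0 l.
  have := pA (v l); rewrite trmxCK AE !mulmxA.
  have -> : row l P *m P ^t* = delta_mx 0 l by rewrite -row_mul (unitarymxP uP) row1.
  have -> : delta_mx 0 l *m diag_mx d *m P *m v l = (d 0 l)%:M.
    rewrite -rowE row_diag_mx -scalemxAl -rowE -scalemxAl.
    have /row_unitarymxP/(_ l l) := uP; rewrite dotmxE eqxx => h.
    by rewrite [_ *m v l]mx11_scalar h scale_scalar_mx mulr1.
  by rewrite mxE eqxx mulr1n.
exists [seq (Num.sqrt (complex.Re (d 0 l)))%:C *: v l | l <- enum 'I_n].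
rewrite big_map big_enum AE' /=; apply: eq_bigr => l _.
rewrite proj_scale normcR real_normK ?num_real // sqr_sqrtr.
  by rewrite RRe_real // ger0_real.
by have := d0 l; rewrite lecE => /andP[].
Qed.

End Psd.

(** * The roof over lists of vectors, and its behaviour under protocols *)

Section Roof.
Variable R : realType.
Local Notation C := R[i].
Local Notation V := 'cV[C]_(2 * 2 * 2).
Local Notation D := 'M[C]_(2 * 2 * 2).
Variable E : V -> R.
Hypothesis E_ge0 : forall psi, 0 <= E psi.
Hypothesis EZ : forall (a : R) psi, 0 <= a -> E (a%:C *: psi) = a ^+ 2 * E psi.
Hypothesis E_local_sum : forall (p : party) n (M : 'I_n -> 'M[C]_2) psi,
  \sum_s (M s) ^t* *m M s = 1%:M -> \sum_s E (local_op p (M s) *m psi) <= E psi.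

(** Weights are absorbed into the vectors: by homogeneity [p * E psi] is [E] at [sqrt p] times
    [psi], so a decomposition is a mere list. *)
Definition roof_set (rho : D) : set R := [set x | exists2 s : seq V,
  rho = \sum_(phi <- s) proj phi & x = \sum_(phi <- s) E phi].

(* The convex roof extended to unnormalised states. *)
Definition roof (rho : D) : R := inf (roof_set rho).

Let sumE_ge0 (s : seq V) : 0 <= \sum_(phi <- s) E phi.
Proof. by apply: sumr_ge0 => phi _. Qed.

Let roof_set_lb (rho : D) : lbound (roof_set rho) 0.
Proof. by move=> _ [s _ ->]. Qed.

Let roof_set_neq0 (rho : D) : psd rho -> roof_set rho !=set0.
Proof. by move=> /psd_decomposition [s hs]; exists (\sum_(phi <- s) E phi), s. Qed.

Lemma roof_ge0 (rho : D) : 0 <= roof rho.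
Proof.
(* The infimum of the empty set is zero by convention. *)
rewrite /roof; have [->|/set0P h] := eqVneq (roof_set rho) set0; first by rewrite inf0.
exact: lb_le_inf.
Qed.

Lemma roof_le (s : seq V) : roof (\sum_(phi <- s) proj phi) <= \sum_(phi <- s) E phi.
Proof. by apply: ge_inf; [exists 0|exists s]. Qed.

Lemma le_roof (rho : D) x : psd rho ->
  (forall s : seq V, rho = \sum_(phi <- s) proj phi -> x <= \sum_(phi <- s) E phi) ->
  x <= roof rho.
Proof.
move=> hrho h; apply: lb_le_inf; first exact: roof_set_neq0.
by move=> _ [s hs ->]; exact: h.
Qed.

Lemma roof0 : roof 0 = 0.
Proof.
apply/eqP; rewrite eq_le roof_ge0 andbT.
by have := roof_le [::]; rewrite !big_nil.
Qed.

(** Decompositions of [A] and of [B] concatenate. *)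
Lemma roofD (A B : D) : psd A -> psd B -> roof (A + B) <= roof A + roof B.
Proof.
move=> hA hB; rewrite -lerBlDr; apply: le_roof => // s ->.
rewrite lerBlDr [X in _ <= X]addrC -lerBlDr; apply: le_roof => // t ->.
by rewrite lerBlDr [X in _ <= X]addrC -!big_cat roof_le.
Qed.

Lemma roof_sum (I : Type) (r : seq I) (A : I -> D) : (forall l, psd (A l)) ->
  roof (\sum_(l <- r) A l) <= \sum_(l <- r) roof (A l).
Proof.
move=> hA; elim: r => [|l r IH]; first by rewrite !big_nil roof0.
rewrite !big_cons; apply: le_trans (roofD (hA l) (psd_sum _ _ hA)) _.
by rewrite lerD2l.
Qed.

Lemma roofZ (c : R) (A : D) : 0 <= c -> psd A -> roof (c%:C *: A) <= c * roof A.
Proof.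
move=> c0 hA; have [->|cn0] := eqVneq c 0; first by rewrite scale0r mul0r roof0.
have cp : 0 < c by rewrite lt_neqAle eq_sym cn0.
rewrite mulrC -ler_pdivrMr //; apply: le_roof => // s ->.
rewrite ler_pdivrMr // mulrC mulr_sumr scaler_sumr.
have := roof_le [seq (Num.sqrt c)%:C *: phi | phi <- s]; rewrite !big_map.
under eq_bigr do rewrite proj_scale normcR real_normK ?num_real // sqr_sqrtr //.
by under [X in _ <= X]eq_bigr do rewrite EZ ?sqrtr_ge0 // sqr_sqrtr //.
Qed.

(** Applying [M s] to each vector of a decomposition of [rho] decomposes the outcome; exchanging
    sums leaves the pure-state inequality. *)
Lemma roof_local_sum (p : party) n (M : 'I_n -> 'M[C]_2) (rho : D) : psd rho ->
  \sum_s (M s) ^t* *m M s = 1%:M ->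
  \sum_s roof (local_op p (M s) *m rho *m (local_op p (M s)) ^t*) <= roof rho.
Proof.
move=> hrho hM; apply: le_roof => // s ->.
have step t : roof (local_op p (M t) *m (\sum_(phi <- s) proj phi) *m (local_op p (M t)) ^t*)
    <= \sum_(phi <- s) E (local_op p (M t) *m phi).
  have := roof_le [seq local_op p (M t) *m phi | phi <- s]; rewrite !big_map.
  by under eq_bigr do rewrite -proj_mul; rewrite -mulmx_suml -mulmx_sumr.
apply: le_trans (ler_sum _ (fun t _ => step t)) _.
by rewrite exchange_big /=; apply: ler_sum => phi _; exact: E_local_sum.
Qed.

Lemma label_mass_psd m (T : protocol R m) (rho : D) l : psd rho -> psd (label_mass T rho l).
Proof.
elim: T rho => [q|p n M next IH] rho hrho /=; first by case: eqP => // _; exact: psd0.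
have op0 s : 0 <= outcome_prob p (M s) rho.
  by have := psd_trace_ge0 (psd_congr (local_op p (M s)) hrho); rewrite lecE => /andP[].
apply: psd_sum => s; apply: (psdZ (op0 s)); apply: IH.
by apply: psdZ; [rewrite invr_ge0|exact: psd_congr].
Qed.

(** Induction on the protocol: subadditivity covers branches averaged under one label, and [roofZ]
    cancels the normalisation of an outcome against its probability. *)
Lemma roof_label_mass m (T : protocol R m) (rho : D) : psd rho -> valid_protocol T ->
  \sum_l roof (label_mass T rho l) <= roof rho.
Proof.
elim: T rho => [q|p n M next IH] rho hrho /=.
  move=> _; rewrite (bigD1 q) //= eqxx big1 ?addr0 // => l lq.
  by rewrite eq_sym (negPf lq) roof0.
move=> [hM hnext].
have op0 s : 0 <= outcome_prob p (M s) rho.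
  by have := psd_trace_ge0 (psd_congr (local_op p (M s)) hrho); rewrite lecE => /andP[].
have pos s : psd (outcome_state p (M s) rho).
  by apply: psdZ; [rewrite invr_ge0|exact: psd_congr].
apply: le_trans (roof_local_sum p hrho hM).
apply: (@le_trans _ _ (\sum_l \sum_s outcome_prob p (M s) rho *
   roof (label_mass (next s) (outcome_state p (M s) rho) l))).
  apply: ler_sum => l _; apply: le_trans (roof_sum _ _) _ => [s|].
    exact: (psdZ (op0 s) (label_mass_psd _ _ (pos s))).
  apply: ler_sum => s _; exact: (roofZ (op0 s) (label_mass_psd _ _ (pos s))).
rewrite exchange_big /=; apply: ler_sum => s _; rewrite -mulr_sumr.
apply: le_trans (ler_wpM2l (op0 s) (IH s _ (pos s) (hnext s))) _.
apply: le_trans (ler_wpM2l (op0 s) (roofZ _ (psd_congr _ hrho))) _.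
  by rewrite invr_ge0.
(* At probability zero the left side is zero, and nonnegativity of the roof suffices. *)
rewrite mulrA; have [->|n0] := eqVneq (outcome_prob p (M s) rho) 0.
  by rewrite mul0r mul0r roof_ge0.
by rewrite divff // mul1r.
Qed.

Lemma label_mass_trace m (T : protocol R m) (rho : D) l : density rho ->
  \tr (label_mass T rho l) = (label_prob T rho l)%:C.
Proof.
elim: T rho => [q|p n M next IH] rho hrho /=.
  by case: hrho => _ _ tr1; case: eqP; rewrite ?mxtrace0.
rewrite raddf_sum rmorph_sum /=; apply: eq_bigr => s _.
rewrite mxtraceZ rmorphM /=.
have [->|n0] := eqVneq (outcome_prob p (M s) rho) 0; first by rewrite !mul0r.
rewrite IH //; apply: psd_density.
  apply: psdZ; last exact/psd_congr/density_psd.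
  rewrite invr_ge0.
  by have := psd_trace_ge0 (psd_congr (local_op p (M s)) (density_psd hrho));
  rewrite lecE => /andP[].
rewrite mxtraceZ; have := psd_trace_ge0 (psd_congr (local_op p (M s)) (density_psd hrho)).
move/ger0_real/RRe_real => <-; rewrite -rmorphM /= -/(rtrace _) -/(outcome_prob _ _ _).
by rewrite mulVf.
Qed.

Lemma label_prob_ge0 m (T : protocol R m) (rho : D) l : density rho ->
  0 <= label_prob T rho l.
Proof.
move=> hrho; rewrite -ler0c -label_mass_trace //.
exact/psd_trace_ge0/label_mass_psd/density_psd.
Qed.

(** A unitary is a measurement with a single outcome. *)
Lemma roof_local_unitary (p : party) (U : 'M[C]_2) (rho : D) : psd rho ->
  U \is unitarymx -> roof (local_op p U *m rho *m (local_op p U) ^t*) <= roof rho.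
Proof.
move=> hrho hU; have := @roof_local_sum p 1 (fun=> U) rho hrho.
by rewrite !big_ord1; apply; exact: unitary_trmxC.
Qed.

Lemma tens3_mul (N N' : party -> 'M[C]_2) :
  tens3 N *m tens3 N' = tens3 (fun p => N p *m N' p).
Proof. by rewrite /tens3 !tensmx_mul. Qed.

Lemma tens3_local (U : party -> 'M[C]_2) :
  tens3 U = local_op ord0 (U ord0) *m
    (local_op (inord 1) (U (inord 1)) *m local_op ord_max (U ord_max)).
Proof.
rewrite /local_op !tens3_mul /tens3 ?eqxx ?partyE.
by rewrite !mulmx1 !mul1mx.
Qed.

Lemma tens3_trmxC (U : party -> 'M[C]_2) : (tens3 U) ^t* = tens3 (fun p => (U p) ^t*).
Proof.
have tC m n p q (A : 'M[C]_(m, n)) (B : 'M[C]_(p, q)) : (A *t B) ^t* = A ^t* *t B ^t*.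
  by rewrite trmx_tens; apply/matrixP => x y; rewrite !mxE rmorphM.
by rewrite /tens3 !tC.
Qed.

Lemma roof_LU_le (U : party -> 'M[C]_2) (rho : D) : psd rho ->
  (forall p, U p \is unitarymx) ->
  roof (tens3 U *m rho *m (tens3 U) ^t*) <= roof rho.
Proof.
move=> hrho hU; rewrite tens3_local !trmxCM.
set A := local_op _ _; set B := local_op _ _; set K := local_op _ _.
have -> : A *m (B *m K) *m rho *m (K ^t* *m B ^t* *m A ^t*) =
  A *m (B *m (K *m rho *m K ^t*) *m B ^t*) *m A ^t* by rewrite !mulmxA.
apply: le_trans (roof_local_unitary _ (psd_congr _ (psd_congr _ hrho)) (hU _)) _.
apply: le_trans (roof_local_unitary _ (psd_congr _ hrho) (hU _)) _.
exact: roof_local_unitary.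
Qed.

Lemma tens3_unitary (U : party -> 'M[C]_2) :
  (forall p, U p \is unitarymx) -> (tens3 U) ^t* *m tens3 U = 1%:M.
Proof.
move=> hU; have h p := unitary_trmxC (hU p).
have t1 m n : (1%:M : 'M[C]_m) *t (1%:M : 'M[C]_n) = 1%:M.
  apply/matrixP => x y; case: (mxtens_indexP x) => a b; case: (mxtens_indexP y) => c d.
  rewrite tensmxE !mxE (can_eq (@mxtens_indexK _ _)) xpair_eqE.
  by case: (a == c); case: (b == d); rewrite ?mulr1 ?mulr0.
by rewrite tens3_trmxC tens3_mul /tens3 !h !t1.
Qed.

(** The inverse unitaries give the reverse inequality. *)
Lemma roof_LU (U : party -> 'M[C]_2) (rho : D) : psd rho ->
  (forall p, U p \is unitarymx) ->
  roof (tens3 U *m rho *m (tens3 U) ^t*) = roof rho.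
Proof.
move=> hrho hU; apply/eqP; rewrite eq_le roof_LU_le //=.
have := roof_LU_le (psd_congr (tens3 U) hrho) (_ : forall p, (U p) ^t* \is unitarymx).
rewrite -tens3_trmxC trmxCK; set W := tens3 U.
have -> : W ^t* *m (W *m rho *m W ^t*) *m W = rho.
  by rewrite !mulmxA tens3_unitary // mul1mx -mulmxA tens3_unitary // mulmx1.
by apply=> p; rewrite trmxC_unitary.
Qed.

(** Squared lengths become weights; zero vectors are dropped first, as they have no
    normalisation. *)
Lemma roof_seq_normalized (rho : D) (s : seq V) : density rho ->
  rho = \sum_(phi <- s) proj phi ->
  exists n (p : 'I_n -> R) (psi : 'I_n -> V),
    [/\ decomposition rho p psi, forall l, 0 < p l &
      [seq phi <- s | phi != 0] = [seq (Num.sqrt (p l))%:C *: psi l | l <- enum 'I_n]].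
Proof.
move=> [_ _ tr1] rhoE; set t := [seq phi <- s | phi != 0].
have rhoE' : rho = \sum_(phi <- t) proj phi.
  rewrite rhoE big_filter [RHS]big_mkcond; apply: eq_bigr => phi _.
  by case: eqVneq => // ->; rewrite /proj mul0mx.
have t0 (l : 'I_(size t)) : nth 0 t l != 0.
  by have := mem_nth 0 (ltn_ord l); rewrite mem_filter => /andP[].
have f0 (l : 'I_(size t)) : 0 < frob (nth 0 t l) := frob_gt0 (t0 l).
pose psi (l : 'I_(size t)) := ((Num.sqrt (frob (nth 0 t l)))^-1)%:C *: nth 0 t l.
have psiE (l : 'I_(size t)) : (Num.sqrt (frob (nth 0 t l)))%:C *: psi l = nth 0 t l.
  by rewrite scalerA -rmorphM /= divff ?scale1r // lt0r_neq0 // sqrtr_gt0.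
exists (size t), (fun l => frob (nth 0 t l)), psi; split=> //; last first.
  apply: (@eq_from_nth _ 0); first by rewrite size_map size_enum_ord.
  move=> l lt; rewrite (nth_map (Ordinal lt)) ?size_enum_ord // psiE.
  by rewrite nth_enum_ord.
split=> [|l|].
- split=> [l|]; first exact: frob_ge0.
  apply: (@complexI R); rewrite -[RHS]tr1 rhoE' [LHS]rmorph_sum [RHS]raddf_sum /=.
  by rewrite (big_nth 0) big_mkord; apply: eq_bigr => l _; rewrite tr_proj.
- rewrite unit_vectorE; apply: (@complexI R).
  rewrite -tr_proj proj_scale mxtraceZ tr_proj normcR real_normK ?num_real // -rmorphM /=.
  by rewrite exprVn sqr_sqrtr ?frob_ge0 // mulVf // lt0r_neq0.
- rewrite rhoE' (big_nth 0) big_mkord; apply: eq_bigr => l _.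
  by rewrite -{1}[nth 0 t l]psiE proj_scale normcR real_normK ?num_real // sqr_sqrtr ?frob_ge0.
Qed.

Variable E1 : V -> R.
Hypothesis E1E : forall psi, unit_vector psi -> E1 psi = E psi.

(** Both infima are over the same set: scaling by roots of weights translates decompositions either
    way, and zero vectors cost nothing. *)
Lemma convex_roofE (rho : D) : density rho -> convex_roof E1 rho = roof rho.
Proof.
move=> hrho; rewrite /convex_roof /roof; congr inf; apply/seteqP; split=> x /=.
  move=> [n [p [psi [[[p0 _] psi1 ->] ->]]]].
  exists [seq (Num.sqrt (p l))%:C *: psi l | l <- enum 'I_n]; rewrite big_map big_enum /=.
    by apply: eq_bigr => l _; rewrite proj_scale normcR real_normK ?num_real // sqr_sqrtr.
  by apply: eq_bigr => l _; rewrite EZ ?sqrtr_ge0 // sqr_sqrtr // E1E.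
move=> [s /(roof_seq_normalized hrho) [n [p [psi [dec p0 sE]]]] ->].
exists n, p, psi; split=> //.
transitivity (\sum_(phi <- [seq phi <- s | phi != 0]) E phi).
  rewrite big_filter [RHS]big_mkcond; apply: eq_bigr => phi _; case: eqVneq => // ->.
  by rewrite -(scale0r (0 : V)) EZ // expr0n mul0r.
rewrite sE big_map big_enum; apply: eq_bigr => l _; case: dec => _ psi1 _.
by rewrite EZ ?sqrtr_ge0 // sqr_sqrtr ?E1E // ltW.
Qed.

Lemma convex_roof_LU_invariant : LU_invariant (convex_roof E1).
Proof.
move=> rho U hrho hU; have prho := density_psd hrho.
rewrite !convex_roofE ?roof_LU //; apply: psd_density; first exact: psd_congr.
by case: hrho => _ _ <-; rewrite mxtrace_mulC mulmxA tens3_unitary // mul1mx.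
Qed.

(** The state of a label, weighted by its probability, costs at most the roof of its mass, to which
    [roof_label_mass] applies. *)
Lemma convex_roof_LOCC_monotone : LOCC_monotone (convex_roof E1).
Proof.
move=> rho m T hrho hT; rewrite (convex_roofE hrho).
apply: le_trans (roof_label_mass (density_psd hrho) hT); apply: ler_sum => l _.
have p0 := label_prob_ge0 T l hrho.
have hmass := label_mass_psd T l (density_psd hrho).
have [->|pn0] := eqVneq (label_prob T rho l) 0; first by rewrite mul0r roof_ge0.
rewrite convex_roofE; last first.
  apply: psd_density; first by apply: psdZ; rewrite ?invr_ge0.
  by rewrite mxtraceZ label_mass_trace // -rmorphM /= mulVf.
apply: le_trans (ler_wpM2l p0 (roofZ _ hmass)) _; first by rewrite invr_ge0.
by rewrite mulrA divff // mul1r.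
Qed.

Lemma convex_roof_convex : convex_measure (convex_roof E1).
Proof.
move=> n p rho [p0 p1] hrho; rewrite convex_roofE; last first.
  apply: psd_density; first by apply: psd_sum => l; apply/psdZ/density_psd.
  rewrite raddf_sum /= -[RHS]/((1 : R)%:C) -p1 rmorph_sum /=; apply: eq_bigr => l _.
  by rewrite mxtraceZ; case: (hrho l) => _ _ ->; rewrite mulr1.
apply: le_trans (roof_sum _ _) _ => [l|]; first by apply/psdZ/density_psd.
apply: ler_sum => l _; rewrite convex_roofE //.
by apply/roofZ/density_psd.
Qed.

End Roof.

(** * Continuity and attainment *)

Section ComplexContinuity.
Variables (R : realType) (X : topologicalType).
Local Notation C := R[i].
Local Notation normc := (@ComplexField.Normc.normc R).
Implicit Types (f g : X -> C) (u v : X -> R).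

Lemma continuous_add u v : continuous u -> continuous v -> continuous (fun x => u x + v x).
Proof. by move=> cu cv x; exact: continuousD (cu x) (cv x). Qed.

Lemma continuous_opp u : continuous u -> continuous (fun x => - u x).
Proof. by move=> cu x; exact: continuousN (cu x). Qed.

Lemma continuous_mul u v : continuous u -> continuous v -> continuous (fun x => u x * v x).
Proof. by move=> cu cv x; exact: continuousM (cu x) (cv x). Qed.

Lemma continuous_sqrt u : continuous u -> continuous (fun x => Num.sqrt (u x)).
Proof. by move=> cu x; exact: continuous_comp (cu x) (@sqrt_continuous R _). Qed.

Lemma continuous_bigsum (I : Type) (r : seq I) (u : I -> X -> R) :
  (forall l, continuous (u l)) -> continuous (fun x => \sum_(l <- r) u l x).
Proof.
move=> cu; elim: r => [|l r IH].
  by under eq_fun do rewrite big_nil; exact: cst_continuous.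
by under eq_fun do rewrite big_cons; apply: continuous_add.
Qed.

(* [R[i]] is not given a topology here; continuity is read off real and
   imaginary parts. *)
Definition ccontinuous f : Prop :=
  continuous (fun x => complex.Re (f x)) /\ continuous (fun x => complex.Im (f x)).

Lemma ccontinuous_cst (c : C) : ccontinuous (fun=> c).
Proof. by split; exact: cst_continuous. Qed.

Lemma eq_ccontinuous f g : f =1 g -> ccontinuous f -> ccontinuous g.
Proof. by move=> /funext ->. Qed.

Lemma ccontinuousD f g : ccontinuous f -> ccontinuous g -> ccontinuous (fun x => f x + g x).
Proof.
move=> [f1 f2] [g1 g2].
have reE : (fun x => complex.Re (f x + g x)) = fun x => complex.Re (f x) + complex.Re (g x).
  by apply/funext => x; case: (f x) (g x) => ? ? [].
have imE : (fun x => complex.Im (f x + g x)) = fun x => complex.Im (f x) + complex.Im (g x).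
  by apply/funext => x; case: (f x) (g x) => ? ? [].
by split; rewrite ?reE ?imE; apply: continuous_add.
Qed.

Lemma ccontinuousM f g : ccontinuous f -> ccontinuous g -> ccontinuous (fun x => f x * g x).
Proof.
move=> [f1 f2] [g1 g2].
have reE : (fun x => complex.Re (f x * g x)) =
    fun x => complex.Re (f x) * complex.Re (g x) + - (complex.Im (f x) * complex.Im (g x)).
  by apply/funext => x; case: (f x) (g x) => ? ? [].
have imE : (fun x => complex.Im (f x * g x)) =
    fun x => complex.Re (f x) * complex.Im (g x) + complex.Im (f x) * complex.Re (g x).
  by apply/funext => x; case: (f x) (g x) => ? ? [].
split; rewrite ?reE ?imE; apply: continuous_add; rewrite -?reE;
  try apply: continuous_opp; exact: continuous_mul.
Qed.

Lemma ccontinuousN f : ccontinuous f -> ccontinuous (fun x => - f x).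
Proof.
move=> cf; apply: (eq_ccontinuous (f := fun x => -1 * f x)) => [x|].
  by rewrite mulN1r.
by apply: ccontinuousM => //; exact: ccontinuous_cst.
Qed.

Lemma ccontinuousJ f : ccontinuous f -> ccontinuous (fun x => conjc (f x)).
Proof.
move=> [f1 f2].
have reE : (fun x => complex.Re (conjc (f x))) = fun x => complex.Re (f x).
  by apply/funext => x; case: (f x).
have imE : (fun x => complex.Im (conjc (f x))) = fun x => - complex.Im (f x).
  by apply/funext => x; case: (f x).
by split; rewrite ?reE ?imE //; apply: continuous_opp.
Qed.

Lemma ccontinuous_sum (I : Type) (r : seq I) (f : I -> X -> C) :
  (forall l, ccontinuous (f l)) -> ccontinuous (fun x => \sum_(l <- r) f l x).
Proof.
move=> cf; elim: r => [|l r IH].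
  by apply: eq_ccontinuous (ccontinuous_cst 0) => x; rewrite big_nil.
by apply: eq_ccontinuous (ccontinuousD (cf l) IH) => x; rewrite big_cons.
Qed.

Lemma continuous_normc f : ccontinuous f -> continuous (fun x => normc (f x)).
Proof.
move=> [f1 f2].
have -> : (fun x => normc (f x)) =
    fun x => Num.sqrt (complex.Re (f x) * complex.Re (f x) + complex.Im (f x) * complex.Im (f x)).
  by apply/funext => x; case: (f x) => a b /=; rewrite !expr2.
by apply: continuous_sqrt; apply: continuous_add; exact: continuous_mul.
Qed.

Lemma continuous_frob n m (A : X -> 'M[C]_(n, m)) :
  (forall a b, ccontinuous (fun x => A x a b)) -> continuous (fun x => frob (A x)).
Proof.
move=> cA; apply: continuous_bigsum => a; apply: continuous_bigsum => b.
under eq_fun do rewrite expr2.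
by apply: continuous_mul; exact: continuous_normc.
Qed.

Lemma continuous_Num_min u v : continuous u -> continuous v ->
  continuous (fun x => Num.min (u x) (v x)).
Proof.
move=> cu cv.
(* The minimum is [(u + v - |u - v|) / 2], with the modulus as the root of a square. *)
have -> : (fun x => Num.min (u x) (v x)) = fun x =>
   (u x + v x + - Num.sqrt ((u x + - v x) * (u x + - v x))) * 2^-1.
  by apply/funext => x; rewrite minr_absE -sqrtr_sqr expr2.
apply: continuous_mul; last exact: cst_continuous.
apply: continuous_add; first exact: continuous_add.
apply: continuous_opp; apply: continuous_sqrt.
by apply: continuous_mul; apply: continuous_add => //; exact: continuous_opp.
Qed.

Lemma continuous_cap (i j k : party) (f : X -> 'cV[C]_(2 * 2 * 2)) :
  (forall y, ccontinuous (fun x => f x y 0)) -> continuous (fun x => cap i j k (f x)).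
Proof.
move=> cf.
have cS a b c : ccontinuous (fun x => slice i j k (f x) c a b).
  by apply: eq_ccontinuous (cf (cbasis (assign i j k a b c))) => x; rewrite mxE.
have cT c d : ccontinuous (fun x => tform i j k (f x) c d).
  apply: (eq_ccontinuous (fun x => esym (tformE i j k (f x) c d))).
  apply: ccontinuousM; last exact: ccontinuous_cst.
  by do 3?[apply: ccontinuousD]; do ?[apply: ccontinuousN]; apply: ccontinuousM.
apply: continuous_sqrt; apply: continuous_add; first exact: continuous_frob.
apply: continuous_mul; first exact: cst_continuous.
apply: continuous_normc.
apply: (eq_ccontinuous (fun x => esym (det2 (tform i j k (f x))))).
by apply: ccontinuousD; do ?[apply: ccontinuousN]; apply: ccontinuousM.
Qed.

End ComplexContinuity.

(** * Decompositions of bounded length and compactness *)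

Section Attainment.
Variable R : realType.
Local Notation C := R[i].
Local Notation V := 'cV[C]_(2 * 2 * 2).
Local Notation D := 'M[C]_(2 * 2 * 2).
Variable E : V -> R.
Hypothesis E_ge0 : forall psi, 0 <= E psi.
Hypothesis EZ : forall (a : R) psi, 0 <= a -> E (a%:C *: psi) = a ^+ 2 * E psi.

Let E0 : E 0 = 0.
Proof. by rewrite -(scale0r (0 : V)) EZ // expr0n mul0r. Qed.

(** The number of real and imaginary parts of the entries of an 8 x 8 complex matrix. *)
Local Notation dim := (8 * 8 + 8 * 8)%N.

(** The coordinate rows of the projectors outnumber their columns. The coefficients are real because
    they serve to shift weights. *)
Lemma real_dependency n (phi : 'I_n -> V) : (dim < n)%N ->
  exists2 c : 'I_n -> R, exists l, c l != 0 &
    \sum_l (c l)%:C *: proj (phi l) = 0.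
Proof.
move=> ndim.
pose A : 'M[R]_(n, dim) := \matrix_l row_mx
  (mxvec (map_mx (@complex.Re R) (proj (phi l)))) (mxvec (map_mx (@complex.Im R) (proj (phi l)))).
have : kermx A != 0.
  rewrite kermx_eq0 /row_free neq_ltn (leq_ltn_trans (rank_leq_col A)) //.
case/rowV0Pn => v /sub_kermxP vA v0.
have [l vl] : exists l, v 0 l != 0.
  apply/existsP; rewrite -negb_forall; apply: contra v0 => /forallP h.
  by apply/eqP/rowP => l; rewrite mxE; exact/eqP.
exists (v 0); first by exists l.
have vAE z : \sum_l v 0 l * A l z = 0 by have /rowP/(_ z) := vA; rewrite !mxE.
apply/matrixP => a b; rewrite summxE mxE.
have hre : \sum_l v 0 l * complex.Re (proj (phi l) a b) = 0.
  rewrite -[RHS](vAE (lshift _ (mxvec_index a b))); apply: eq_bigr => m _.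
  by rewrite [A _ _]mxE row_mxEl mxvecE [map_mx _ _ _ _]mxE.
have him : \sum_l v 0 l * complex.Im (proj (phi l) a b) = 0.
  rewrite -[RHS](vAE (rshift _ (mxvec_index a b))); apply: eq_bigr => m _.
  by rewrite [A _ _]mxE row_mxEr mxvecE [map_mx _ _ _ _]mxE.
transitivity ((\sum_l v 0 l * complex.Re (proj (phi l) a b))%:C +
   'i%C * (\sum_l v 0 l * complex.Im (proj (phi l) a b))%:C); last first.
  by rewrite hre him mulr0 addr0.
rewrite !rmorph_sum mulr_sumr -big_split /=; apply: eq_bigr => m _.
by rewrite mxE {1}[proj _ _ _]complexE !rmorphM /=; ring.
Qed.

(* Caratheodory: moving the weights along a linear dependency, in the direction
   that does not increase the cost, until one of them vanishes. *)
Lemma caratheodory_step (s : seq V) : (dim < size s)%N ->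
  exists t : seq V, [/\ (size t < size s)%N,
    \sum_(phi <- t) proj phi = \sum_(phi <- s) proj phi &
    \sum_(phi <- t) E phi <= \sum_(phi <- s) E phi].
Proof.
move=> hs; set n := size s in hs *; pose phi (l : 'I_n) := nth 0 s l.
have [c [[l0 cl0] [dep cost]]] : exists c : 'I_n -> R, (exists l, 0 < c l) /\
    (\sum_l (c l)%:C *: proj (phi l) = 0 /\ 0 <= \sum_l c l * E (phi l)).
  have [c [l cl] dep] := real_dependency phi hs.
  have depN : \sum_l (- c l)%:C *: proj (phi l) = 0.
    by under eq_bigr do rewrite rmorphN scaleNr; rewrite sumrN dep oppr0.
  have sumN : \sum_l (- c l) * E (phi l) = - \sum_l c l * E (phi l).
    by rewrite -sumrN; apply: eq_bigr => m _; rewrite mulNr.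
  wlog cost : c cl dep depN sumN / 0 <= \sum_l c l * E (phi l).
    move=> W; have [pos|neg] := leP 0 (\sum_l c l * E (phi l)); first exact: (W c).
    apply: (W (fun l => - c l)); rewrite ?oppr_eq0 //.
    - by under eq_bigr do rewrite opprK.
    - by rewrite sumN opprK; apply: eq_bigr => m _; rewrite opprK.
    - by rewrite sumN oppr_ge0 ltW.
  (* If no coefficient is positive, the cost is also nonpositive, so the negated dependency
     qualifies. *)
  have [/existsP cpos|] := boolP [exists l, 0 < c l]; first by exists c.
  rewrite negb_exists => /forallP npos.
  exists (fun l => - c l); split.
    by exists l; rewrite oppr_gt0 lt_neqAle cl leNgt npos.
  split=> //; rewrite sumN oppr_ge0; apply: sumr_le0 => m _.
  by rewrite mulr_le0_ge0 // leNgt npos.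
case: (arg_maxP c (isT : predT l0)) => l1 _ max1.
have cl1 : 0 < c l1 by exact: lt_le_trans cl0 (max1 l0 isT).
(* Dividing by the largest coefficient keeps all weights nonnegative and makes that of [l1] zero. *)
pose w l := 1 - c l / c l1.
have w0 l : 0 <= w l by rewrite subr_ge0 ler_pdivrMr // mul1r; exact: max1.
have w1 : w l1 = 0 by rewrite /w divff ?subrr // lt0r_neq0.
exists [seq (Num.sqrt (w l))%:C *: phi l | l <- enum 'I_n & l != l1]; split.
- rewrite size_map size_filter -[X in (_ < X)%N](size_enum_ord n) -(count_predC (pred1 l1)).
  by rewrite -[X in (X < _)%N]add0n ltn_add2r -has_count has_pred1 mem_enum.
- rewrite big_map big_filter big_enum_cond /=.
  transitivity (\sum_l (w l)%:C *: proj (phi l)).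
    rewrite [RHS](bigD1 l1) //= w1 scale0r add0r; apply: eq_bigr => l _.
    by rewrite proj_scale normcR real_normK ?num_real // sqr_sqrtr.
  rewrite [RHS](big_nth 0) big_mkord -/n.
  transitivity (\sum_l (proj (phi l) - ((c l1)^-1)%:C *: ((c l)%:C *: proj (phi l)))).
    apply: eq_bigr => l _.
    by rewrite rmorphB rmorph1 scalerBl scale1r scalerA -rmorphM mulrC.
  by rewrite sumrB -scaler_sumr dep scaler0 subr0.
- rewrite big_map big_filter big_enum_cond /=.
  apply: (@le_trans _ _ (\sum_l w l * E (phi l))).
    rewrite [leRHS](bigD1 l1) //= w1 mul0r add0r; apply: ler_sum => l _.
    by rewrite EZ ?sqrtr_ge0 // sqr_sqrtr.
  rewrite [leRHS](big_nth 0) big_mkord -/n.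
  have -> : \sum_l w l * E (phi l) = \sum_l E (phi l) - (c l1)^-1 * \sum_l c l * E (phi l).
    by rewrite mulr_sumr -sumrB; apply: eq_bigr => l _; rewrite /w; ring.
  by rewrite gerBl mulr_ge0 // invr_ge0 ltW.
Qed.

(** Padding with zero vectors makes the length exactly [dim], so that all decompositions live in one
    fixed space. *)
Lemma caratheodory (s : seq V) : exists t : seq V, [/\ size t = dim,
    \sum_(phi <- t) proj phi = \sum_(phi <- s) proj phi &
    \sum_(phi <- t) E phi <= \sum_(phi <- s) E phi].
Proof.
have [m] := ubnP (size s); elim: m s => // m IH s sm.
have [small|/caratheodory_step [t [ts <- le1]]] := leqP (size s) dim; last first.
  have [u [h1 h2 h3]] := IH t (leq_trans ts sm).
  by exists u; split=> //; exact: le_trans le1.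
exists (s ++ nseq (dim - size s) 0); split.
- by rewrite size_cat size_nseq subnKC.
- rewrite big_cat /= [X in _ + X]big1_seq ?addr0 // => phi /andP[_].
  by move=> /nseqP[-> _]; rewrite /proj mul0mx.
- rewrite big_cat /= [X in _ + X]big1_seq ?addr0 // => phi /andP[_].
  by move=> /nseqP[-> _]; rewrite E0.
Qed.

Hypothesis E_continuous : forall (X : topologicalType) (f : X -> V),
  (forall y, ccontinuous (fun x => f x y 0)) -> continuous (fun x => E (f x)).

Local Notation X := ('rV[R]_(dim * 8 * 2)).

(** Families of [dim] vectors become points of a real coordinate space, where boxes are compact. *)
Let decode (x : X) (l : 'I_dim) : V := \col_y
  Complex (x 0 (mxtens_index (mxtens_index (l, y), 0)))
          (x 0 (mxtens_index (mxtens_index (l, y), 1))).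

Let decode_surj (t : seq V) : exists x, forall l, decode x l = nth 0 t l.
Proof.
exists (\row_z let v := nth 0 t (mxtens_unindex (mxtens_unindex z).1).1
   (mxtens_unindex (mxtens_unindex z).1).2 0 in
   if (mxtens_unindex z).2 == 0 then complex.Re v else complex.Im v) => l.
apply/matrixP => y z; rewrite (ord1 z) !mxE !mxtens_indexK /=.
by case: (nth 0 t l y 0).
Qed.

Let decode_cont l y : ccontinuous (fun x => decode x l y 0).
Proof.
split.
  have -> : (fun x => complex.Re (decode x l y 0)) =
      fun x : X => x 0 (mxtens_index (mxtens_index (l, y), 0)).
    by apply/funext => x; rewrite mxE.
  exact: coord_continuous.
have -> : (fun x => complex.Im (decode x l y 0)) =
    fun x : X => x 0 (mxtens_index (mxtens_index (l, y), 1)).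
  by apply/funext => x; rewrite mxE.
exact: coord_continuous.
Qed.

(** Decompositions of length [dim] form a compact set on which the continuous cost attains its
    minimum; by [caratheodory] no longer decomposition is cheaper. *)
Lemma roof_attained (rho : D) : psd rho ->
  exists2 s : seq V, rho = \sum_(phi <- s) proj phi & \sum_(phi <- s) E phi = roof E rho.
Proof.
move=> hrho.
pose K : set X := [set x | \sum_l proj (decode x l) = rho].
have Kclosed : closed K.
  have -> : K = (fun x => frob (\sum_l proj (decode x l) - rho)) @^-1` [set 0].
    apply/seteqP; split=> x /=.
      move=> ->; rewrite subrr; apply: (@complexI R).
      by rewrite frob_trmxCl mul0mx mxtrace0.
    move=> h; apply/eqP; rewrite -subr_eq0; apply: contraT => /frob_gt0.
    by rewrite h ltxx.
  apply: preimage_closed; last exact: closed_eq.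
  move=> x _; apply: continuous_frob => a b.
  apply: (eq_ccontinuous (f := fun x => \sum_l (decode x l a 0 * conjc (decode x l b 0))
     + (- rho a b))) => [z|].
    by rewrite !mxE summxE; congr (_ + _); apply: eq_bigr => l _; rewrite projE.
  apply: ccontinuousD; last exact: ccontinuous_cst.
  apply: ccontinuous_sum => l; apply: ccontinuousM => //.
  exact: ccontinuousJ.
(* The trace of [rho] is the sum of the squared lengths of the vectors, so it bounds the square of
   every real coordinate. *)
pose B := Num.sqrt (complex.Re (\tr rho)).
have Kcompact : compact K.
  apply: (@subclosed_compact _ _ [set v : X | forall z, `[- B, B]%classic (v ord0 z)]) => //.
    by apply: (@rV_compact _ _ (fun=> `[- B, B]%classic)) => z; exact: segment_compact.
  move=> x Kx z /=; rewrite in_itv /= -ler_norml -sqrtr_sqr ler_sqrt; last first.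
    by have := psd_trace_ge0 hrho; rewrite lecE => /andP[].
  case: (mxtens_indexP z) => q b; case: (mxtens_indexP q) => l y.
  have -> : \tr rho = (\sum_m frob (decode x m))%:C.
    by rewrite -Kx [LHS]raddf_sum rmorph_sum; apply: eq_bigr => m _; exact: tr_proj.
  rewrite /= (bigD1 l) //=.
  apply: (@le_trans _ _ (frob (decode x l))); last first.
    by rewrite lerDl; apply: sumr_ge0 => m _; exact: frob_ge0.
  rewrite /frob (bigD1 y) //= big_ord1.
  apply: (@le_trans _ _ (ComplexField.Normc.normc (decode x l y 0) ^+ 2)); last first.
    rewrite lerDl; apply: sumr_ge0 => m _; apply: sumr_ge0 => m' _; exact: sqr_ge0.
  rewrite normc_sqrE mxE /=.
  by case: (ord2P b) => ->; rewrite ?lerDl ?lerDr sqr_ge0.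
have encode (s : seq V) : rho = \sum_(phi <- s) proj phi ->
    exists2 x, K x & \sum_l E (decode x l) <= \sum_(phi <- s) E phi.
  move=> rhoE; have [t [st tE le1]] := caratheodory s.
  have [x hx] := decode_surj t; exists x; last first.
    apply: le_trans le1; rewrite [leRHS](big_nth 0) big_mkord st.
    by apply: ler_sum => l _; rewrite hx.
  by rewrite /K /= rhoE -tE [RHS](big_nth 0) big_mkord st; apply: eq_bigr => l _; rewrite hx.
have [s0 /encode [x0 Kx0 _]] := psd_decomposition hrho.
have [|x /set_mem Kx xmin] := compact_EVT_min (ex_intro _ x0 Kx0) Kcompact
    (f := fun x => \sum_l E (decode x l)).
  apply: continuous_subspaceT; apply: continuous_bigsum => l.
  by apply: E_continuous => y; exact: decode_cont.
have rhoE : rho = \sum_(phi <- [seq decode x l | l <- enum 'I_dim]) proj phi.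
  by rewrite big_map big_enum.
exists [seq decode x l | l <- enum 'I_dim] => //; apply/eqP; rewrite eq_le.
rewrite {2}rhoE roof_le // andbT big_map big_enum /=.
apply: le_roof => // s /encode [y Ky]; apply: le_trans.
by apply: xmin; exact: mem_set.
Qed.

End Attainment.

(** * From properties on pure states to a GME measure *)

Section Measure.
Variable R : realType.
Local Notation C := R[i].
Local Notation V := 'cV[C]_(2 * 2 * 2).
Variables E E1 : V -> R.
Hypothesis E_ge0 : forall psi, 0 <= E psi.
Hypothesis EZ : forall (a : R) psi, 0 <= a -> E (a%:C *: psi) = a ^+ 2 * E psi.
Hypothesis E_local_sum : forall (p : party) n (M : 'I_n -> 'M[C]_2) psi,
  \sum_s (M s) ^t* *m M s = 1%:M -> \sum_s E (local_op p (M s) *m psi) <= E psi.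
Hypothesis E_continuous : forall (X : topologicalType) (f : X -> V),
  (forall y, ccontinuous (fun x => f x y 0)) -> continuous (fun x => E (f x)).
Hypothesis E_eq0 : forall psi, E psi = 0 <-> biseparable_pure psi.
Hypothesis E1E : forall psi, unit_vector psi -> E1 psi = E psi.

(** A biseparable decomposition costs zero. Conversely a zero roof is attained, so each term of an
    optimal decomposition costs zero and its vector is biseparable. *)
Lemma convex_roof_detects_GME : detects_GME (convex_roof E1).
Proof.
move=> rho hrho; rewrite (convex_roofE EZ E1E hrho); split.
  move=> pos [n [p [psi [[[p0 _] _ rhoE] bis]]]].
  have := roof_le E_ge0 [seq (Num.sqrt (p l))%:C *: psi l | l <- enum 'I_n].
  rewrite big_map big_enum [X in _ <= X]big_map big_enum /=.
  have -> : \sum_l proj ((Num.sqrt (p l))%:C *: psi l) = rho.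
    by rewrite rhoE; apply: eq_bigr => l _;
       rewrite proj_scale normcR real_normK ?num_real // sqr_sqrtr.
  rewrite big1 => [|l _]; first by rewrite leNgt pos.
  by rewrite EZ ?sqrtr_ge0 // (iffRL (E_eq0 _) (bis l)) mulr0.
move=> nbis; rewrite lt_neqAle roof_ge0 // andbT; apply/eqP => roof_eq0; apply: nbis.
have [s rhoE] := roof_attained E_ge0 EZ E_continuous (density_psd hrho).
rewrite -roof_eq0 => /eqP; rewrite psumr_eq0 // => /allP s0.
have [n [p [psi [dec p0 sE]]]] := roof_seq_normalized hrho rhoE.
exists n, p, psi; split=> // l; apply/E_eq0.
have : (Num.sqrt (p l))%:C *: psi l \in [seq phi <- s | phi != 0].
  by rewrite sE; apply: map_f; rewrite mem_enum.
rewrite mem_filter => /andP[_ /s0]; rewrite EZ ?sqrtr_ge0 // sqr_sqrtr ?ltW //.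
by rewrite mulf_eq0 gt_eqF //= => /eqP.
Qed.

Lemma convex_roof_GME_measure : GME_measure (convex_roof E1).
Proof.
split.
- exact: convex_roof_detects_GME.
- exact: (convex_roof_LU_invariant E_ge0 EZ E_local_sum E1E).
- exact: (convex_roof_LOCC_monotone E_ge0 EZ E_local_sum E1E).
- exact: (convex_roof_convex E_ge0 EZ E1E).
Qed.

End Measure.

(** * Superadditivity of the minimum and of the geometric mean *)

Section Sums.
Variable R : realType.

Lemma sum_min (I : Type) (r : seq I) (F G : I -> R) :
  \sum_(s <- r) Num.min (F s) (G s) <= Num.min (\sum_(s <- r) F s) (\sum_(s <- r) G s).
Proof.
by rewrite le_min !ler_sum // => s _; rewrite ge_min lexx ?orbT.
Qed.

(** Cauchy-Schwarz for the vectors [sqrt a, sqrt c] and [sqrt b, sqrt d]. *)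
Lemma sqrt_mulD (a b c d : R) : 0 <= a -> 0 <= b -> 0 <= c -> 0 <= d ->
  Num.sqrt (a * b) + Num.sqrt (c * d) <= Num.sqrt ((a + c) * (b + d)).
Proof.
move=> a0 b0 c0 d0.
rewrite -(@ler_pXn2r _ 2) ?nnegrE ?addr_ge0 ?sqrtr_ge0 //.
rewrite sqr_sqrtr ?mulr_ge0 ?addr_ge0 // !sqrtrM //.
rewrite -[in leRHS](sqr_sqrtr a0) -[in leRHS](sqr_sqrtr b0)
  -[in leRHS](sqr_sqrtr c0) -[in leRHS](sqr_sqrtr d0).
move: (Num.sqrt a) (Num.sqrt b) (Num.sqrt c) (Num.sqrt d) => x y z t.
by have := sqr_ge0 (x * t - y * z); nra.
Qed.

Lemma sum_sqrt_mul (I : Type) (r : seq I) (F G : I -> R) :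
  (forall s, 0 <= F s) -> (forall s, 0 <= G s) ->
  \sum_(s <- r) Num.sqrt (F s * G s) <=
    Num.sqrt ((\sum_(s <- r) F s) * (\sum_(s <- r) G s)).
Proof.
move=> F0 G0; elim: r => [|s r IH]; first by rewrite !big_nil mul0r sqrtr0.
rewrite !big_cons; apply: le_trans (sqrt_mulD _ _ _ _); rewrite ?sumr_ge0 //.
by rewrite lerD2l.
Qed.

End Sums.

(** * Minimum and geometric mean of the two capacities *)

Section Capacities.
Variable R : realType.
Local Notation C := R[i].
Local Notation V := 'cV[C]_(2 * 2 * 2).
Variables (i j k : party).
Hypothesis hijk : uniq [:: i; j; k].

Let hikj : uniq [:: i; k; j].
Proof.
move: hijk; rewrite /= !inE !negb_or => /and3P[/andP[ij ik] jk _].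
by rewrite ij ik eq_sym jk.
Qed.

(** The extension of [Tmin] from unit vectors that is homogeneous of degree two; [capgm] plays the
    same role for [TGM]. *)
Definition capmin (psi : V) : R := Num.min (2 * cap i j k psi) (2 * cap i k j psi).

Definition capgm (psi : V) : R := Num.sqrt ((2 * cap i j k psi) * (2 * cap i k j psi)).

Let cap2_ge0 a b c (psi : V) : 0 <= 2 * cap a b c psi.
Proof. by rewrite mulr_ge0 ?cap_ge0. Qed.

Let cap2_sum a b c (p : party) n (M : 'I_n -> 'M[C]_2) psi : uniq [:: a; b; c] ->
  \sum_s (M s) ^t* *m M s = 1%:M ->
  \sum_s 2 * cap a b c (local_op p (M s) *m psi) <= 2 * cap a b c psi.
Proof. by move=> habc hM; rewrite -mulr_sumr ler_wpM2l // cap_local_sum. Qed.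

Let cap2_continuous a b c (X : topologicalType) (f : X -> V) :
  (forall y, ccontinuous (fun x => f x y 0)) -> continuous (fun x => 2 * cap a b c (f x)).
Proof. by move=> cf; apply: continuous_mul; [exact: cst_continuous|exact: continuous_cap]. Qed.

Let biseparable_capP (psi : V) :
  (cap i j k psi = 0 \/ cap i k j psi = 0) <-> biseparable_pure psi.
Proof.
split=> [[]|]; [exact: cap_eq0_biseparable|exact: cap_eq0_biseparable|].
exact: biseparable_cap_eq0.
Qed.

Lemma GME_measure_Tmin : GME_measure (convex_roof (@Tmin R i j k)).
Proof.
apply: (@convex_roof_GME_measure _ capmin).
- by move=> psi; rewrite le_min; apply/andP; split; exact: cap2_ge0.
- move=> a psi a0; rewrite /capmin !(capZ _ _ _ _ a0) ![2 * (_ * _)]mulrCA.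
  by rewrite -minr_pMr ?exprn_ge0.
- move=> p n M psi hM; apply: le_trans (sum_min _ _ _) _.
  rewrite le_min; apply/andP; split; rewrite ge_min; apply/orP; [left|right];
  exact: cap2_sum.
- move=> X f cf; exact: continuous_Num_min (cap2_continuous cf) (cap2_continuous cf).
- move=> psi; rewrite -biseparable_capP /capmin; split.
    by case: leP => _ /eqP; rewrite mulf_eq0 pnatr_eq0 => /eqP; [left|right].
  by case=> ->; rewrite mulr0; [rewrite min_l|rewrite min_r].
- by move=> psi /unit_vectorE psi1; rewrite /Tmin !tele_capE.
Qed.

Lemma GME_measure_TGM : GME_measure (convex_roof (@TGM R i j k)).
Proof.
apply: (@convex_roof_GME_measure _ capgm).
- by move=> psi; exact: sqrtr_ge0.
- move=> a psi a0; rewrite /capgm !(capZ _ _ _ _ a0).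
  have -> (x y : R) : 2 * (a ^+ 2 * x) * (2 * (a ^+ 2 * y)) = (a ^+ 2) ^+ 2 * (2 * x * (2 * y)).
    by ring.
  by rewrite sqrtrM ?sqr_ge0 // sqrtr_sqr ger0_norm ?sqr_ge0.
- move=> p n M psi hM; apply: le_trans (sum_sqrt_mul _ _ _) _ => //.
  by apply: ler_wsqrtr; apply: ler_pM; rewrite ?sumr_ge0 ?cap2_sum.
- move=> X f cf; apply: continuous_sqrt.
  exact: continuous_mul (cap2_continuous cf) (cap2_continuous cf).
- move=> psi; rewrite -biseparable_capP /capgm; split.
    move/eqP; rewrite sqrtr_eq0 => h; have := mulr_ge0 (cap2_ge0 i j k psi) (cap2_ge0 i k j psi).
    move=> h'; have /eqP : (2 * cap i j k psi) * (2 * cap i k j psi) = 0.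
      by apply/eqP; rewrite eq_le h h'.
    by rewrite !mulf_eq0 !pnatr_eq0 /= => /orP[] /eqP; [left|right].
  by case=> ->; rewrite !mulr0 ?mul0r sqrtr0.
- by move=> psi /unit_vectorE psi1; rewrite /TGM !tele_capE.
Qed.

End Capacities.

Theorem theorem6 (R : realType) (i j k : party) (hijk : uniq [:: i; j; k]) :
  GME_measure (convex_roof (@Tmin R i j k)) /\
  GME_measure (convex_roof (@TGM R i j k)).
Proof. by split; [exact: GME_measure_Tmin|exact: GME_measure_TGM]. Qed.
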